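(* Let $K$ be a field of characteristic zero, let $n\ge 0$, and let $R=K[X_0,X_1,\ldots,X_n]$ be standard graded ($\deg X_i=1$ for all $i$). Let $A_{n+1}(K)=K\langle X_0,\ldots,X_n,\partial_0,\ldots,\partial_n\rangle$ be the $(n+1)$-th Weyl algebra, graded with $\deg X_i=1$ and $\deg\partial_i=-1$. Let $N$ be a graded, holonomic, generalized Eulerian left $A_{n+1}(K)$-module. If $N=N_{X_0}$ (that is, the natural map from $N$ to its localization at $X_0$ is bijective), then $$\chi^c(\partial,N)=0,$$ where $\chi^c(\partial,N)$ is the Euler characteristic of the de Rham cohomology of $N$.
   Context: Let $\epsilon=\sum_{i=0}^n X_i\partial_i$ be the Euler operator. A graded $A_{n+1}(K)$-module $N$ is generalized Eulerian if for every homogeneous $z\in N$, of degree $|z|$, there is a positive integer $a$ (depending on $z$) with $(\epsilon-|z|)^a z=0$. For a left $A_{n+1}(K)$-module $N$, the de Rham complex of $N$ is the Koszul (cochain) complex on $N$ of the commuting $K$-linear maps $\partial=\partial_0,\ldots,\partial_n$: in cohomological degree $p$ it is $\bigwedge^p K^{n+1}\otimes_K N$, with differential $e_J\otimes m\mapsto \sum_{i=0}^n e_i\wedge e_J\otimes \partial_i m$. Its cohomology is $H^p(\partial;N)$. When $N$ is holonomic, all $H^p(\partial;N)$ are finite-dimensional over $K$ (known), and $\chi^c(\partial,N)=\sum_{p=0}^{n+1}(-1)^p\dim_K H^p(\partial;N)$. The zero module is counted as holonomic. *)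

(* Defs.v *)
From HB Require Import structures.
From mathcomp Require Import all_boot all_order all_algebra.
From mathcomp Require Import zify.
From mathcomp Require Import boolp classical_sets.

Set Implicit Arguments.
Unset Strict Implicit.
Unset Printing Implicit Defensive.

Import Order.TTheory GRing.Theory Num.Theory.
Local Open Scope ring_scope.
Local Open Scope classical_set_scope.
Local Open Scope quotient_scope.

(* The vector spaces below are typically infinite-dimensional, so subspaces
   are Prop-valued sets rather than {vspace _}. *)
Section Subspaces.
Variables (K : fieldType) (V : lmodType K).

Definition is_subspace (U : set V) : Prop :=
  U 0 /\ forall (a : K) u v, U u -> U v -> U (a *: u + v).

Definition lin_span (S : set V) : set V :=
  [set v | exists (r : nat) (c : 'I_r -> K) (e : 'I_r -> V),
     (forall i, S (e i)) /\ v = \sum_(i < r) c i *: e i].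

(* For subspaces B `<=` Z, this says that the quotient Z / B has a basis with
   r elements, namely the classes of the e i. *)
Definition has_quot_dim (Z B : set V) (r : nat) : Prop :=
  exists e : 'I_r -> V,
    [/\ forall i, Z (e i),
        forall z, Z z -> exists c : 'I_r -> K, B (z - \sum_(i < r) c i *: e i)
      & forall c : 'I_r -> K, B (\sum_(i < r) c i *: e i) ->
          forall i, c i = 0].

Definition has_dim (U : set V) (r : nat) : Prop := has_quot_dim U [set 0] r.

(* dim_K (Z / B), with value 0 when Z / B is not finite-dimensional. *)
Definition quot_dim (Z B : set V) : nat := xget 0%N (has_quot_dim Z B).

End Subspaces.

(* A left module over the m-th Weyl algebra K<X_i, D_i | i < m>, presented by
   [X_i, X_j] = [D_i, D_j] = 0 and [D_i, X_j] = delta_ij: a K-vector space with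
   an action of the generators that satisfies the relations. *)
Record weyl_module (K : fieldType) (m : nat) (N : lmodType K) := WeylModule {
  wX : 'I_m -> {linear N -> N};
  wD : 'I_m -> {linear N -> N};
  wXX : forall i j z, wX i (wX j z) = wX j (wX i z);
  wDD : forall i j z, wD i (wD j z) = wD j (wD i z);
  wDX : forall i j z, wD i (wX j z) - wX j (wD i z) = (i == j)%:R *: z }.

Section WeylModules.
Variables (K : fieldType) (m : nat) (N : lmodType K) (W : weyl_module m N).

(* N is the internal direct sum of the subspaces Ng d, for d in Z. *)
Record is_graded (Ng : int -> set N) : Prop := IsGraded {
  graded_sub : forall d, is_subspace (Ng d);
  graded_gen : forall z, exists (s : seq int) (f : int -> N),
    (forall d, Ng d (f d)) /\ z = \sum_(d <- s) f d;
  graded_free : forall (s : seq int) (f : int -> N), uniq s ->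
    (forall d, Ng d (f d)) -> \sum_(d <- s) f d = 0 ->
    forall d, d \in s -> f d = 0;
  graded_X : forall i d z, Ng d z -> Ng (d + 1) (wX W i z);
  graded_D : forall i d z, Ng d z -> Ng (d - 1) (wD W i z) }.

Definition euler_op (z : N) : N := \sum_(i < m) wX W i (wD W i z).

Definition generalized_eulerian (Ng : int -> set N) : Prop :=
  forall (d : int) (z : N), Ng d z ->
    exists a : nat, (0 < a)%N /\
      iter a (fun w => euler_op w - d%:~R *: w) z = 0.

(* The action of X^a D^b. *)
Definition weyl_monomial (a b : 'I_m -> nat) (z : N) : N :=
  foldr (fun i => iter (a i) (wX W i))
    (foldr (fun i => iter (b i) (wD W i)) z (enum 'I_m)) (enum 'I_m).

(* B_t G, where B_t is the t-th step of the Bernstein filtration: the span of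
   the X^a D^b with |a| + |b| <= t. *)
Definition bernstein_mul (t : nat) (G : set N) : set N :=
  lin_span [set z | exists (a b : 'I_m -> nat) (g : N),
    [/\ (\sum_(i < m) a i + \sum_(i < m) b i <= t)%N, G g
      & z = weyl_monomial a b g]].

(* Good filtrations with respect to the Bernstein filtration; one exists iff
   N is finitely generated over the Weyl algebra. *)
Record good_filtration (G : nat -> set N) : Prop := GoodFiltration {
  gf_sub : forall t, is_subspace (G t);
  gf_findim : forall t, exists r, has_dim (G t) r;
  gf_incr : forall t, G t `<=` G t.+1;
  gf_exhaustive : forall z, exists t, G t z;
  gf_mul : forall i t, bernstein_mul i (G t) `<=` G (i + t)%N;
  gf_good : exists t0, forall i t, (t0 <= t)%N ->
    G (i + t)%N = bernstein_mul i (G t) }.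

(* P is the Hilbert polynomial of the filtration G. *)
Definition hilbert_poly (G : nat -> set N) (P : {poly rat}) : Prop :=
  exists t0, forall t, (t0 <= t)%N ->
    exists2 r, has_dim (G t) r & P.[t%:R] = r%:R.

(* N is nonzero, finitely generated and of Bernstein dimension d, the degree of
   the Hilbert polynomial (which does not depend on the good filtration). *)
Definition has_weyl_dim (d : nat) : Prop :=
  exists (G : nat -> set N) (P : {poly rat}),
    [/\ good_filtration G, hilbert_poly G P & size P = d.+1].

Definition holonomic : Prop := (forall z : N, z = 0) \/ has_weyl_dim m.

(* The whole exterior algebra tensored with N: w J is the coefficient in N of
   e_J = e_j1 /\ ... /\ e_jp, where J = {j1 < ... < jp}. *)
Definition dR_form := {ffun {set 'I_m} -> N}.

Definition dR_deg (p : nat) : set dR_form :=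
  [set w | forall J : {set 'I_m}, #|J| != p -> w J = 0].

(* e_i /\ e_J is 0 if i \in J, and otherwise (-1)^s e_L with L = i |: J and
   s the number of j in J (equivalently, in L) such that j < i. *)
Definition dR_diff (w : dR_form) : dR_form :=
  [ffun L : {set 'I_m} => \sum_(i in L)
     (-1) ^+ #|[set j in L | (j < i)%N]%SET| *: wD W i (w (L :\ i)%SET)].

Definition dR_cocycles (p : nat) : set dR_form :=
  [set w | dR_deg p w /\ dR_diff w = 0].

Definition dR_coboundaries (p : nat) : set dR_form :=
  if p is q.+1 then dR_diff @` dR_deg q else [set 0].

Definition dR_cohomology_dim (p : nat) : nat :=
  quot_dim (dR_cocycles p) (dR_coboundaries p).

Definition dR_euler_char : int :=
  \sum_(p < m.+1) (-1) ^+ p * (dR_cohomology_dim p)%:Z.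

End WeylModules.

(* The localization of N at the powers of x: fractions z / x^k, encoded as
   pairs (z, k). *)
Section Localization.
Variables (K : fieldType) (N : lmodType K) (x : {linear N -> N}).

Definition loc_rel (u v : N * nat) : bool :=
  `[< exists s : nat,
        iter s x (iter v.2 x u.1) = iter s x (iter u.2 x v.1) >].

Lemma loc_rel_refl : reflexive loc_rel.
Proof. by move=> u; apply/asboolP; exists 0%N. Qed.

Lemma loc_rel_sym : symmetric loc_rel.
Proof. by move=> u v; apply/asboolP/asboolP => -[s e]; exists s. Qed.

Lemma loc_rel_trans : transitive loc_rel.
Proof.
move=> v u w /asboolP[s e] /asboolP[t f]; apply/asboolP.
exists (s + t + v.2)%N; rewrite -!iterD in e f *.
have -> : (s + t + v.2 + w.2 = t + w.2 + (s + v.2))%N by lia.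
have -> : (s + t + v.2 + u.2 = s + u.2 + (t + v.2))%N by lia.
rewrite iterD e [RHS]iterD -f -!iterD; congr iter; lia.
Qed.

Canonical loc_equiv := EquivRel loc_rel loc_rel_refl loc_rel_sym loc_rel_trans.

Definition localization := {eq_quot loc_equiv}.

Definition loc_map (z : N) : localization := \pi_localization (z, 0%N).

End Localization.

(* Main.v *)
Require Import Defs.
From HB Require Import structures.
From mathcomp Require Import all_boot all_order all_algebra.
From mathcomp Require Import boolp classical_sets.
From mathcomp Require Import zify ring.

(* Peeling off the last variable, the Koszul complex of D_0, ..., D_k on a
   subquotient Z / B of N is the mapping cone of D_k acting on the complex of
   D_0, ..., D_(k-1), so its Euler characteristic is that of ker D_k minus that
   of coker D_k.  Finiteness is carried along as a growth bound: if the images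
   of a filtration in Z / B grow at most like t^(k+1), then those in ker D_k and
   coker D_k grow at most like t^k, because the X_k^l e (for e in ker D_k),
   resp. the D_k^l e (for lifts e of elements of coker D_k), are linearly
   independent; growth t^0 means finite dimension.  The generalized Eulerian
   property with a uniform exponent (N is finitely generated) also passes to
   ker D_k and coker D_k, and so does the invertibility of X_0 when k > 0.
   When only one variable remains, T = X_0 D_0 is the Euler operator, and
   ker D_0 = ker T, coker D_0 = coker T as X_0 is invertible; these have equal
   dimensions by Fitting's lemma. *)

Set Implicit Arguments.
Unset Strict Implicit.
Unset Printing Implicit Defensive.

Import Order.TTheory GRing.Theory Num.Theory.
Local Open Scope ring_scope.

(** * Dimensions of subquotients *)

(** The kernel and cokernel of D_k are modules only over the Weyl algebra in the remaining
    variables. They are kept as pairs of subsets [Z] and [B] of the one space [N], so iterating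
    never builds a quotient, and the filtration [G] of [N] serves at every stage. Growth is carried
    as an upper bound because such a bound can be tested on free families inside [G], without asking
    that the induced filtrations be good.

    The variable X_0 is kept for the end because its inverse commutes with every other D_i. With E_k
    the sum of the X_i D_i for i < k, one has E_(k+1) = E_k + X_k D_k, and X_k D_k = D_k X_k - 1
    acts as 0 on ker D_k and as -1 on coker D_k. Hence generalized eigenvectors keep their exponent
    while eigenvalues move by 0 or 1, and it is enough to carry annihilating polynomials instead of
    a grading.

    The exponent must be uniform because the subquotients may be infinite-dimensional: it is what
    makes the chain of the ker T^l stop. Characteristic zero enters through the integers l+1
    produced by commuting D_k past powers of X_k, and conversely. *)

Section SubspaceTheory.
Variables (K : fieldType) (V : lmodType K).
Implicit Types (Z B U : set V) (u v : V).

Lemma subspace0 U : is_subspace U -> U 0.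
Proof. by case. Qed.

Lemma subspaceD U u v : is_subspace U -> U u -> U v -> U (u + v).
Proof. by move=> [_ sU] Uu Uv; rewrite -[u]scale1r; apply: sU. Qed.

Lemma subspaceZ U a u : is_subspace U -> U u -> U (a *: u).
Proof. by move=> [U0 sU] Uu; rewrite -[_ *: _]addr0; apply: sU. Qed.

Lemma subspaceN U u : is_subspace U -> U u -> U (- u).
Proof. by move=> sU Uu; rewrite -scaleN1r; apply: subspaceZ. Qed.

Lemma subspaceB U u v : is_subspace U -> U u -> U v -> U (u - v).
Proof. by move=> sU Uu Uv; apply: subspaceD => //; apply: subspaceN. Qed.

Lemma subspace_sum U (I : Type) (r : seq I) (P : pred I) (F : I -> V) :
  is_subspace U -> (forall i, P i -> U (F i)) -> U (\sum_(i <- r | P i) F i).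
Proof.
move=> sU UF; elim/big_ind: _ => //; first exact: subspace0.
by move=> x y; apply: subspaceD.
Qed.

Lemma subspaceZr U a u : is_subspace U -> a != 0 -> U (a *: u) -> U u.
Proof.
by move=> sU a0 Uu; rewrite -[u](scalerK a0); apply: subspaceZ.
Qed.

Lemma subspace_congr U u v : is_subspace U -> U (u - v) -> U u <-> U v.
Proof.
move=> sU Uuv; split=> [Uu|Uv]; last by rewrite -(subrK v u); apply: subspaceD.
by rewrite -[v](subKr u); apply: subspaceB.
Qed.

Lemma subspaceT : is_subspace ([set: V]%classic).
Proof. by []. Qed.

Lemma subspace1 : is_subspace ([set 0]%classic : set V).
Proof. by split=> // a u v -> ->; rewrite scaler0 addr0. Qed.

Definition qfree B r (e : 'I_r -> V) :=
  forall c : 'I_r -> K, B (\sum_(i < r) c i *: e i) -> forall i, c i = 0.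

(** Steinitz modulo [B]: a row vector killing the matrix of coefficients of the [f j] in the [e i]
    would be a relation among the [f j], so the matrix has full row rank. *)
Lemma qfree_le Z B r s (e : 'I_r -> V) (f : 'I_s -> V) : is_subspace B ->
  (forall z, Z z -> exists c : 'I_r -> K, B (z - \sum_(i < r) c i *: e i)) ->
  (forall i, Z (f i)) -> qfree B f -> (s <= r)%N.
Proof.
move=> sB spe Zf frf; have /choice[A fA] : forall j, exists c : 'I_r -> K,
    B (f j - \sum_(i < r) c i *: e i) by move=> j; apply/spe.
pose M := \matrix_(j < s, i < r) A j i.
suff /eqP <- : row_free M by apply: rank_leq_col.
apply/row_freeP/row_freeP; rewrite -kermx_eq0; apply/eqP/row_matrixP => k.
rewrite row0; set u := row k _; have uM : u *m M = 0.
  by apply/sub_kermxP; apply: row_sub.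
apply/rowP => j; rewrite [RHS]mxE; move: j; apply: frf.
suff -> : \sum_(j < s) u 0 j *: f j =
    \sum_(j < s) u 0 j *: (f j - \sum_(i < r) A j i *: e i).
  by apply: subspace_sum => // j _; apply: subspaceZ.
under [RHS]eq_bigr => j _ do rewrite scalerBr.
rewrite sumrB; have -> : \sum_j u 0 j *: (\sum_i A j i *: e i) = 0.
  under eq_bigr => j _ do rewrite scaler_sumr.
  rewrite exchange_big /=; apply: big1 => i _.
  under eq_bigr => j _ do rewrite scalerA.
  rewrite -scaler_suml -[RHS](scale0r (e i)); congr (_ *: _).
  have /rowP/(_ i) := uM; rewrite [LHS]mxE [RHS]mxE => uMi; rewrite -[RHS]uMi.
  by apply: eq_bigr => j _; rewrite [X in _ = _ * X]mxE.
by rewrite subr0.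
Qed.

Lemma has_quot_dim_uniq Z B r s : is_subspace B ->
  has_quot_dim Z B r -> has_quot_dim Z B s -> r = s.
Proof.
move=> sB [e [Ze spe fre]] [f [Zf spf frf]]; apply/eqP; rewrite eqn_leq.
by rewrite (qfree_le sB spf Ze fre) (qfree_le sB spe Zf frf).
Qed.

Lemma quot_dimE Z B r : is_subspace B -> has_quot_dim Z B r -> quot_dim Z B = r.
Proof.
move=> sB hr; apply: has_quot_dim_uniq (hr) => //.
by apply: (@xgetPex _ 0%N (has_quot_dim Z B)); exists r.
Qed.

(** A free family of maximal size spans, since adjoining any further [z] breaks freeness. This turns
    a growth bound, which speaks only of free families, into a dimension. *)
Lemma bounded_has_quot_dim Z B C : is_subspace B ->
  (forall r (e : 'I_r -> V), (forall i, Z (e i)) -> qfree B e -> (r <= C)%N) ->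
  exists r, has_quot_dim Z B r.
Proof.
move=> sB bnd.
pose P r := `[< exists e : 'I_r -> V, (forall i, Z (e i)) /\ qfree B e >].
have P0 : exists r, P r.
  by exists 0%N; apply/asboolP; exists (fun=> 0); split=> [[]|c _ []].
have PC r : P r -> (r <= C)%N by move=> /asboolP[e [Ze fre]]; apply: bnd fre.
case: (ex_maxnP P0 PC) => r /asboolP[e [Ze fre]] rmax; exists r, e; split=> //.
move=> z Zz; apply: contrapT => nz.
suff /rmax : P r.+1 by rewrite ltnn.
apply/asboolP; exists (fun i => if unlift ord0 i is Some j then e j else z).
split=> [i|c]; first by case: unliftP.
rewrite big_ord_recl unlift_none; under eq_bigr => i _ do rewrite liftK.
have [c0 Bc|c0 Bc] := eqVneq (c ord0) 0; last first.
  case: nz; exists (fun i => - (c ord0)^-1 * c (lift ord0 i)).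
  apply: (subspaceZr sB c0); rewrite scalerBr scaler_sumr -sumrN.
  under eq_bigr => i _ do rewrite scalerA mulrA mulrN divff // mulN1r scaleNr opprK.
  exact: Bc.
move: Bc; rewrite c0 scale0r add0r => /fre frc i.
by case: (unliftP ord0 i) => [j ->|->].
Qed.

Lemma has_quot_dim_bound Z B r : is_subspace B -> has_quot_dim Z B r ->
  forall s (e : 'I_s -> V), (forall i, Z (e i)) -> qfree B e -> (s <= r)%N.
Proof. by move=> sB [e [Ze spe fre]] s f Zf; apply: qfree_le sB spe Zf. Qed.

Lemma has_quot_dim_add Z Y B r s : is_subspace Z -> is_subspace Y ->
  is_subspace B -> (B `<=` Y)%classic -> (Y `<=` Z)%classic ->
  has_quot_dim Z Y r -> has_quot_dim Y B s -> has_quot_dim Z B (r + s).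
Proof.
move=> sZ sY sB BY YZ [e [Ze spe fre]] [f [Yf spf frf]].
exists (fun i => match split i with inl j => e j | inr j => f j end).
have sumE (c : 'I_(r + s) -> K) :
    \sum_i c i *: match split i with inl j => e j | inr j => f j end =
    \sum_i c (lshift s i) *: e i + \sum_i c (rshift r i) *: f i.
  rewrite big_split_ord /=; congr (_ + _); apply: eq_bigr => i _.
    by rewrite (unsplitK (inl i)).
  by rewrite (unsplitK (inr i)).
split=> [i|z Zz|c].
- by case: split => j //; apply: YZ.
- have [c Yc] := spe z Zz; have [d Bd] := spf _ Yc.
  exists (fun i => match split i with inl j => c j | inr j => d j end).
  rewrite sumE (_ : \sum_i _ = \sum_i c i *: e i); last first.
    by apply: eq_bigr => i _; rewrite (unsplitK (inl i)).
  rewrite (_ : \sum_(i < s) _ = \sum_i d i *: f i) ?opprD ?addrA //.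
  by apply: eq_bigr => i _; rewrite (unsplitK (inr i)).
- rewrite sumE => Bc; have c0 : forall i, c (lshift s i) = 0.
    apply: fre; apply/(subspace_congr (u := 
      \sum_i c (lshift s i) *: e i + \sum_i c (rshift r i) *: f i)) => //.
      by rewrite addrAC subrr add0r; apply: subspace_sum => // i _; apply: subspaceZ.
    exact: BY.
  move: Bc; rewrite big1 ?add0r => [/frf c1 i|i _]; last by rewrite c0 scale0r.
  by rewrite -(splitK i); case: (split i) => j; [apply: c0|apply: c1].
Qed.

Lemma has_quot_dim_split Z Y B t : is_subspace Z -> is_subspace Y ->
  is_subspace B -> (B `<=` Y)%classic -> (Y `<=` Z)%classic ->
  has_quot_dim Z B t ->
  exists r s, [/\ has_quot_dim Z Y r, has_quot_dim Y B s & t = (r + s)%N].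
Proof.
move=> sZ sY sB BY YZ ht.
have [r hr] : exists r, has_quot_dim Z Y r.
  apply: (@bounded_has_quot_dim _ _ t) => // r e Ze fre.
  by apply: (has_quot_dim_bound sB ht Ze) => c /BY; apply: fre.
have [s hs] : exists s, has_quot_dim Y B s.
  apply: (@bounded_has_quot_dim _ _ t) => // s e Ye.
  by apply: (has_quot_dim_bound sB ht) => i; apply: YZ.
exists r, s; split=> //; apply: has_quot_dim_uniq ht _ => //.
exact: has_quot_dim_add hr hs.
Qed.

(** The kernel of [f] on [Z / B] changes only the numerator, to [subker f Z B]; the cokernel changes
    only the denominator, to [subcoker f Z B]. Both stay subquotients of [V]. *)
Definition subker (f : V -> V) Z B : set V := fun z => Z z /\ B (f z).
Definition subcoker (f : V -> V) Z B : set V :=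
  fun z => Z z /\ exists2 y, Z y & B (z - f y).

Lemma subspace_subker (f : {linear V -> V}) Z B :
  is_subspace Z -> is_subspace B -> is_subspace (subker f Z B).
Proof.
move=> sZ sB; split; first by split; rewrite ?linear0; apply: subspace0.
by move=> a u v [Zu Bu] [Zv Bv]; split; rewrite ?linearP; [apply: sZ.2|apply: sB.2].
Qed.

Lemma subspace_subcoker (f : {linear V -> V}) Z B :
  is_subspace Z -> is_subspace B -> is_subspace (subcoker f Z B).
Proof.
move=> sZ sB; split.
  split; first exact: subspace0.
  by exists 0; [|rewrite linear0 subr0]; apply: subspace0.
move=> a u v [Zu [x Zx Bx]] [Zv [y Zy By]]; split; first exact: sZ.2.
exists (a *: x + y); first exact: sZ.2.
by rewrite linearP opprD addrACA -scalerBr; apply: sB.2.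
Qed.

Lemma sub_subcoker (f : {linear V -> V}) Z B : is_subspace Z ->
  (B `<=` Z)%classic -> (B `<=` subcoker f Z B)%classic.
Proof.
move=> sZ BZ z Bz; split; first exact: BZ.
by exists 0; [apply: subspace0|rewrite linear0 subr0].
Qed.

Lemma image_subcoker (f : {linear V -> V}) Z B z : is_subspace B ->
  (forall y, Z y -> Z (f y)) -> Z z -> subcoker f Z B (f z).
Proof.
move=> sB fZ Zz; split; first exact: fZ.
by exists z => //; rewrite subrr; apply: subspace0.
Qed.

End SubspaceTheory.

(* An isomorphism Z / B ~ Z' / B' given by a linear correspondence, which saves
   choosing representatives when the map is only defined on classes. *)
Lemma has_quot_dim_rel (K : fieldType) (V V' : lmodType K) (Z B : set V)
    (Z' B' : set V') (R : V -> V' -> Prop) r :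
  is_subspace Z -> is_subspace Z' -> R 0 0 ->
  (forall a u v u' v', R u u' -> R v v' -> R (a *: u + v) (a *: u' + v')) ->
  (forall z, Z z -> exists2 z', Z' z' & R z z') ->
  (forall z', Z' z' -> exists2 z, Z z & R z z') ->
  (forall z z', Z z -> Z' z' -> R z z' -> B z <-> B' z') ->
  has_quot_dim Z B r -> has_quot_dim Z' B' r.
Proof.
move=> sZ sZ' R0 RD RZ RZ' RB [e [Ze spe fre]].
have /choice[f Rf] : forall i, exists z', Z' z' /\ R (e i) z'.
  by move=> i; have [z' ? ?] := RZ _ (Ze i); exists z'.
have Rsum c : R (\sum_i c i *: e i) (\sum_i c i *: f i).
  by elim/big_ind2: _ => // [u u' v v' Ru Rv|i _];
    [rewrite -[u]scale1r -[u']scale1r|rewrite -[c i *: e i]addr0 -[c i *: f i]addr0];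
    apply: RD => //; case: (Rf i).
have Zsum c : Z (\sum_i c i *: e i).
  by apply: subspace_sum => // i _; apply: subspaceZ.
have Z'sum c : Z' (\sum_i c i *: f i).
  by apply: subspace_sum => // i _; apply: subspaceZ => //; case: (Rf i).
exists f; split=> [i|z' Z'z'|c B'c]; first by case: (Rf i).
  have [z Zz Rz] := RZ' _ Z'z'; have [c Bc] := spe _ Zz; exists c.
  have Rc : R (z - \sum_i c i *: e i) (z' - \sum_i c i *: f i).
    by rewrite ![_ - _]addrC -!scaleN1r; apply: RD.
  by apply/(RB _ _ _ _ Rc) => //; apply: subspaceB.
by apply: fre; apply/(RB _ _ (Zsum c) (Z'sum c) (Rsum c)).
Qed.

(** * The long exact sequence of a mapping cone *)

Section Complexes.
Variables (K : fieldType) (V : lmodType K).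

Definition cocycles (d : V -> V) (Z B : int -> set V) (p : int) : set V :=
  fun z => Z p z /\ B (p + 1) (d z).

Definition coboundaries (d : V -> V) (Z B : int -> set V) (p : int) : set V :=
  fun z => Z p z /\ exists2 y, Z (p - 1) y & B p (z - d y).

(** All terms [Z p / B p] sit in one ambient space, on which [d] squares to zero exactly and not
    only modulo [B]. Integer degrees keep [p - 1] meaningful at the bottom. *)
Record subquot_complex (d : V -> V) (Z B : int -> set V) : Prop := SubquotComplex {
  sc_Z : forall p, is_subspace (Z p);
  sc_B : forall p, is_subspace (B p);
  sc_BZ : forall p z, B p z -> Z p z;
  sc_dZ : forall p z, Z p z -> Z (p + 1) (d z);
  sc_dB : forall p z, B p z -> B (p + 1) (d z);
  sc_dd : forall z, d (d z) = 0 }.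

Lemma subspace_cocycles (d : {linear V -> V}) Z B p :
  subquot_complex d Z B -> is_subspace (cocycles d Z B p).
Proof.
move=> C; have sZ := sc_Z C p; have sB := sc_B C (p + 1); split.
  by split; [apply: subspace0|rewrite raddf0; apply: subspace0].
move=> a u v [Zu Bu] [Zv Bv]; split; first by apply: sZ.2.
by rewrite linearP; apply: sB.2.
Qed.

Lemma subspace_coboundaries (d : {linear V -> V}) Z B p :
  subquot_complex d Z B -> is_subspace (coboundaries d Z B p).
Proof.
move=> C; have sZ := sc_Z C; have sB := sc_B C; split.
  split; first exact: subspace0.
  exists 0; rewrite ?(raddf0 d) ?subr0; first exact: subspace0 (sZ _).
  exact: subspace0 (sB _).
move=> a u v [Zu [x Zx Bx]] [Zv [y Zy By]]; split; first by apply: (sZ _).2.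
exists (a *: x + y); first by apply: (sZ _).2.
rewrite linearP opprD addrACA -scalerBr; exact: (sB _).2.
Qed.

Lemma coboundaries_cocycles (d : {linear V -> V}) Z B p : subquot_complex d Z B ->
  (coboundaries d Z B p `<=` cocycles d Z B p)%classic.
Proof.
move=> C z [Zz [y Zy Bzy]]; split=> //.
by rewrite -[d z]subr0 -(sc_dd C y) -raddfB; apply: (sc_dB C).
Qed.

End Complexes.

Section Cone.
Variables (K : fieldType) (V : lmodType K) (d D : {linear V -> V}).
Variables (Z B : int -> set V).
Hypothesis C : subquot_complex d Z B.
Hypothesis DZ : forall p z, Z p z -> Z p (D z).
Hypothesis DB : forall p z, B p z -> B p (D z).
Hypothesis dD : forall z, d (D z) = D (d z).

Definition kerZ (p : int) : set V := subker D (Z p) (B p).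
Definition cokerB (p : int) : set V := subcoker D (Z p) (B p).

(** Total complex of the double complex with rows Z and Z joined by D, the second row shifted by one
    degree. Its cohomology is assembled from H^p(ker) and H^(p-1)(coker), up to a connecting map
    H^(p-1)(coker) -> H^(p+1)(ker). *)
Definition cone_d (w : V * V) : V * V := (d w.1, D w.1 - d w.2).
Definition coneS (Z : int -> set V) (p : int) : set (V * V) :=
  fun w => Z p w.1 /\ Z (p - 1) w.2.

Let sZ := sc_Z C. Let sB := sc_B C.

Lemma complex_ker : subquot_complex d kerZ B.
Proof.
split=> [p|p|p z Bz|p z [Zz Bz]|p z|z].
- exact: subspace_subker.
- exact: sB.
- by split; [apply: (sc_BZ C)|apply: DB].
- by split; [apply: (sc_dZ C)|rewrite -dD; apply: (sc_dB C)].
- exact: (sc_dB C).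
- exact: (sc_dd C).
Qed.

Lemma complex_coker : subquot_complex d Z cokerB.
Proof.
split=> [p|p|p z [] //|p z|p z [Zz [y Zy Bzy]]|z].
- exact: sZ.
- exact: subspace_subcoker.
- exact: (sc_dZ C).
- split; first exact: (sc_dZ C).
  by exists (d y); [apply: (sc_dZ C)|rewrite -dD -raddfB; apply: (sc_dB C)].
- exact: (sc_dd C).
Qed.

Lemma cone_d_linear a u v : cone_d (a *: u + v) = a *: cone_d u + cone_d v.
Proof.
by rewrite /cone_d /= !(linearP d) (linearP D) opprD addrACA -scalerBr.
Qed.

HB.instance Definition _ := GRing.isLinear.Build K (V * V)%type (V * V)%type _
  cone_d cone_d_linear.

Lemma complex_cone : subquot_complex cone_d (coneS Z) (coneS B).
Proof.
have sC (U : int -> set V) p : (forall p, is_subspace (U p)) -> is_subspace (coneS U p).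
  move=> sU; split; first by split; apply: subspace0.
  by move=> a u v [? ?] [? ?]; split; apply: (sU _).2.
have dC (U : int -> set V) p w : (forall p, is_subspace (U p)) ->
    (forall p z, U p z -> U (p + 1) (d z)) -> (forall p z, U p z -> U p (D z)) ->
    coneS U p w -> coneS U (p + 1) (cone_d w).
  move=> sU dU DU [U1 U2]; split; first exact: dU.
  rewrite /= addrK; apply: subspaceB => //; first exact: DU.
  by rewrite -(subrK 1 p); apply: dU.
split=> [p|p|p w [? ?]|p w|p w|w].
- exact: sC.
- exact: sC.
- by split; apply: (sc_BZ C).
- by apply: dC => //; apply: (sc_dZ C).
- by apply: dC => //; apply: (sc_dB C).
- by rewrite /cone_d /= raddfB /= !(sc_dd C) dD subr0 subrr.
Qed.

(* The image of H^p(cone) in H^(p-1)(coker), and the kernel of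
   H^p(ker) -> H^p(cone). *)
Let I (p : int) : set V := fun b =>
  cocycles d Z cokerB (p - 1) b /\
  exists a, cocycles cone_d (coneS Z) (coneS B) p (a, b).
Let J (p : int) : set V := fun a =>
  cocycles d kerZ B p a /\ coboundaries cone_d (coneS Z) (coneS B) p (a, 0).

Let sI p : is_subspace (I p).
Proof.
have sQ := subspace_cocycles (p - 1) complex_coker.
have sC := subspace_cocycles p complex_cone.
split; first by split; [apply: subspace0 sQ|exists 0; apply: subspace0 sC].
move=> a u v [Qu [x Cx]] [Qv [y Cy]]; split; first by apply: sQ.2.
by exists (a *: x + y); apply: (sC.2 a (x, u) (y, v)).
Qed.

Let sJ p : is_subspace (J p).
Proof.
have sQ := subspace_cocycles p complex_ker.
have sC := subspace_coboundaries p complex_cone.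
split; first by split; [apply: subspace0 sQ|apply: subspace0 sC].
move=> a u v [Qu Cx] [Qv Cy]; split; first by apply: sQ.2.
have -> : (a *: u + v, 0) = a *: (u, 0 : V) + (v, 0).
  by congr pair; rewrite /= scaler0 addr0.
exact: sC.2.
Qed.


Let bnd_I p : (coboundaries d Z cokerB (p - 1) `<=` I p)%classic.
Proof.
move=> b Hb; split; first exact: coboundaries_cocycles complex_coker _ Hb.
case: Hb => Zb [y Zy [_ [z Zz Bz]]]; exists (d z); split.
  by split=> //; rewrite -(subrK 1 p); apply: (sc_dZ C).
split; first by rewrite /= (sc_dd C); apply: subspace0 (sB _).
rewrite /= addrK (_ : D (d z) - d b = - d (b - d y - D z)).
  by apply: subspaceN => //; have := sc_dB C Bz; rewrite subrK.
by rewrite !(raddfB d) /= (sc_dd C) subr0 dD opprB.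
Qed.

Let bnd_J p : (coboundaries d kerZ B p `<=` J p)%classic.
Proof.
move=> a Ha; split; first exact: coboundaries_cocycles complex_ker _ Ha.
case: Ha => [[Za _] [y [Zy By] Bay]]; split; first by split=> //; apply: subspace0.
exists (y, 0); first by split=> //; apply: subspace0.
split=> //=; rewrite (raddf0 d) subr0 sub0r; exact: subspaceN.
Qed.

(** The connecting map: if d b = D a modulo [B], the class of b goes to that of d a, which D kills
    because D d a = d D a = d d b = 0. Modulo coboundaries its kernel is [I p] and its image
    [J (p + 1)]. *)
Let coker_ker_dim p r :
  has_quot_dim (cocycles d Z cokerB (p - 1)) (I p) r ->
  has_quot_dim (J (p + 1)) (coboundaries d kerZ B (p + 1)) r.
Proof.
apply: (has_quot_dim_rel (R := fun b k => exists2 a, Z p a &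
    B (p + 1) (k - d a) /\ B p (D a - d b))).
- exact: subspace_cocycles complex_coker.
- exact: sJ.
- exists 0; first exact: subspace0 (sZ _).
  by rewrite !(raddf0 d) (raddf0 D) !subr0; split; apply: subspace0 (sB _).
- move=> c u v u' v' [x Zx [Bx Bx']] [y Zy [By By']].
  exists (c *: x + y); first exact: (sZ _).2.
  rewrite !(linearP d) (linearP D) !opprD.
  by split; rewrite addrACA -scalerBr; apply: (sB _).2.
- move=> b [Zb]; rewrite subrK => -[Zdb [a Za Bba]]; exists (d a); last first.
    exists a => //; rewrite subrr -opprB.
    by split; [apply: subspace0 (sB _)|apply: subspaceN].
  have Zda := sc_dZ C Za; split; last first.
    split; first by split=> //; apply: subspace0 (sZ _).
    exists (a, b); first by split=> //=; rewrite addrK.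
    split=> /=; first by rewrite subrr; apply: subspace0 (sB _).
    by rewrite addrK sub0r opprB.
  split; last by rewrite (sc_dd C); apply: subspace0 (sB _).
  split=> //; rewrite -dD -[d (D a)]subr0 -(sc_dd C b) -(raddfB d) -opprB (raddfN d).
  by apply: subspaceN => //; apply: (sc_dB C).
- move=> k [_ [_ [[a b]]]]; rewrite addrK => -[/= Za Zb] [/= Bk].
  rewrite addrK sub0r opprB => Bab; exists b; last first.
    by exists a => //; split=> //; rewrite -opprB; apply: subspaceN.
  split=> //; rewrite subrK; split.
    by have := sc_dZ C Zb; rewrite subrK.
  by exists a.
- move=> b k Qb [[[Zk Bk] Bdk] Jk] [a Za [Bka Bab]]; split.
    move=> [_ [x [[/= Zx _] [/= Bx]]]]; rewrite addrK => Bxb.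
    split=> //; exists (a - x); first rewrite addrK.
      split; first exact: subspaceB.
      rewrite (raddfB D) /= -[D a](subrK (d b)) -addrA -[d b - D x]opprB.
      exact: subspaceB.
    rewrite (raddfB d) /= opprB addrA addrAC.
    by apply: subspaceD.
  move=> [_ [y [Zy By] Bky]]; split=> //; exists (a - y); split.
    by split=> /=; [apply: subspaceB => //; rewrite addrK in Zy|case: Qb].
  split=> /=.
    rewrite (_ : d (a - y) = k - d y - (k - d a)); first exact: subspaceB.
    by rewrite (raddfB d) /= opprB [RHS]addrC addrA subrK.
  rewrite addrK (raddfB D) /= addrAC; apply: subspaceB => //.
  by rewrite addrK in By.
Qed.

(** Middle step between coboundaries and cocycles of the cone: the classes that die in
    H^(p-1)(coker), which are also those coming from H^p(ker). *)
Let Y (p : int) : set (V * V) := fun w =>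
  cocycles cone_d (coneS Z) (coneS B) p w /\ coboundaries d Z cokerB (p - 1) w.2.

Let sY p : is_subspace (Y p).
Proof.
have sC := subspace_cocycles p complex_cone.
have sQ := subspace_coboundaries (p - 1) complex_coker.
split; first by split; [apply: subspace0 sC|apply: subspace0 sQ].
by move=> c u v [Cu Qu] [Cv Qv]; split; [apply: sC.2|apply: sQ.2].
Qed.

Let cone_image_dim p r :
  has_quot_dim (I p) (coboundaries d Z cokerB (p - 1)) r ->
  has_quot_dim (cocycles cone_d (coneS Z) (coneS B) p) (Y p) r.
Proof.
apply: (has_quot_dim_rel (R := fun b w => b = w.2)) => //.
- exact: subspace_cocycles complex_cone.
- by move=> c u v u' v' -> ->.
- by move=> b [_ [a Cab]]; exists (a, b).
- move=> [a b] Cab; exists b => //; split; last by exists a.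
  case: (Cab) => [[/= Za Zb] [/= Bda]]; rewrite addrK => Bab; split=> //.
  rewrite subrK; split; first by have := sc_dZ C Zb; rewrite subrK.
  by exists a => //; rewrite -opprB; apply: subspaceN.
- by move=> b w Ib Cw ->; split=> // -[].
Qed.

Let cone_kernel_dim p r :
  has_quot_dim (cocycles d kerZ B p) (J p) r ->
  has_quot_dim (Y p) (coboundaries cone_d (coneS Z) (coneS B) p) r.
Proof.
have sC := subspace_coboundaries p complex_cone.
apply: (has_quot_dim_rel (R := fun k w =>
  coboundaries cone_d (coneS Z) (coneS B) p (w - (k, 0 : V)))) => //.
- exact: subspace_cocycles complex_ker.
- by rewrite subr0; apply: subspace0 sC.
- move=> c u v u' v' Ru Rv.
  rewrite (_ : _ - _ = c *: (u' - (u, 0 : V)) + (v' - (v, 0 : V))).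
    exact: sC.2.
  rewrite scalerBr addrACA -opprD; congr (_ - _).
  by congr pair; rewrite /= scaler0 addr0.
- move=> k [[Zk Bk] Bdk]; exists (k, 0); last by rewrite subrr; apply: subspace0 sC.
  split; last by apply: subspace0; apply: subspace_coboundaries complex_coker.
  split; first by split=> //; apply: subspace0.
  by split=> //=; rewrite addrK (raddf0 d) subr0.
- move=> [a b] [[[/= Za Zb] [/= Bda]]]; rewrite addrK => Bab.
  move=> [/= _ [y Zy [_ [z Zz Bz]]]].
  have Zdz : Z p (d z) by have := sc_dZ C Zz; rewrite subrK.
  (* Subtracting the cone differential of (z, -y) from (a, b) clears the second component modulo
     [B]. *)
  exists (a - d z).
    split; last by rewrite (raddfB d) /= (sc_dd C) subr0.
    split; first exact: subspaceB.
    rewrite (_ : D _ = (D a - d b) + d (b - d y - D z)).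
      by apply: subspaceD => //; have := sc_dB C Bz; rewrite subrK.
    by rewrite !(raddfB d) (raddfB D) /= (sc_dd C) subr0 dD addrA subrK.
  split; first by split=> /=; rewrite ?subKr ?subr0.
  exists (z, - y); first by split=> //=; apply: subspaceN.
  split=> /=; first by rewrite subKr subrr; apply: subspace0.
  by rewrite subr0 (raddfN d) opprK opprD addrA addrAC.
- move=> k w Ck Yw Rkw; rewrite (subspace_congr sC Rkw).
  by split=> // -[].
Qed.

(** [r p] is the rank of the connecting map from H^(p-1)(coker) to H^(p+1)(ker). The identity counts
    dimensions along the long exact sequence; the two bounds will force [r] to vanish outside the
    range of degrees. *)
Lemma cone_dims (hK hQ : int -> nat) :
  (forall p, has_quot_dim (cocycles d kerZ B p) (coboundaries d kerZ B p) (hK p)) ->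
  (forall p, has_quot_dim (cocycles d Z cokerB p) (coboundaries d Z cokerB p) (hQ p)) ->
  exists h r : int -> nat,
    (forall p, has_quot_dim (cocycles cone_d (coneS Z) (coneS B) p)
       (coboundaries cone_d (coneS Z) (coneS B) p) (h p)) /\
    (forall p, [/\ (h p + r p + r (p - 1)%R = hQ (p - 1)%R + hK p)%N,
       (r p <= hQ (p - 1)%R)%N & (r p <= hK (p + 1)%R)%N]).
Proof.
move=> dimK dimQ.
have /choice[r /choice[i rP]] : forall p, exists r i,
    [/\ has_quot_dim (cocycles d Z cokerB (p - 1)) (I p) r,
        has_quot_dim (I p) (coboundaries d Z cokerB (p - 1)) i
      & hQ (p - 1) = (r + i)%N].
  move=> p; apply: has_quot_dim_split (dimQ _) => //.
  - exact: subspace_cocycles complex_coker.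
  - exact: subspace_coboundaries complex_coker.
  - by move=> z [].
have /choice[k /choice[j kP]] : forall p, exists k j,
    [/\ has_quot_dim (cocycles d kerZ B p) (J p) k,
        has_quot_dim (J p) (coboundaries d kerZ B p) j
      & hK p = (k + j)%N].
  move=> p; apply: has_quot_dim_split (dimK _) => //.
  - exact: subspace_cocycles complex_ker.
  - exact: subspace_coboundaries complex_ker.
  - by move=> z [].
have jr p : j (p + 1) = r p.
  have [hr _ _] := rP p; have [_ hj _] := kP (p + 1).
  apply: has_quot_dim_uniq hj (coker_ker_dim hr).
  exact: subspace_coboundaries complex_ker.
exists (fun p => i p + k p)%N, r; split=> p.
  have [_ hi _] := rP p; have [hk _ _] := kP p.
  apply: has_quot_dim_add (cone_image_dim hi) (cone_kernel_dim hk).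
  - exact: subspace_cocycles complex_cone.
  - exact: sY.
  - exact: subspace_coboundaries complex_cone.
  - move=> w Hw; split; first exact: coboundaries_cocycles complex_cone _ Hw.
    case: Hw => [[_ Zw] [[z y] [/= Zz Zy] [/= _ Bw]]]; split=> //.
    exists (- y); first exact: subspaceN.
    rewrite (raddfN d) opprK; split.
      by apply: subspaceD => //; have := sc_dZ C Zy; rewrite subrK.
    by exists z => //; move: Bw; rewrite opprB addrA.
  - by move=> w [].
have [_ _ ->] := rP p; have [_ _ hKp] := kP p; have [_ _ hKp1] := kP (p + 1).
rewrite hKp1 jr; split; last by rewrite leq_addl.
  by rewrite hKp -(jr (p - 1)) subrK; lia.
by rewrite leq_addr.
Qed.

End Cone.

(** * Partial Koszul complexes *)

Section PartialKoszul.
Variables (K : fieldType) (m : nat) (N : lmodType K) (W : weyl_module m N).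
Local Notation form := {ffun {set 'I_m} -> N}.
Implicit Types (w : form) (J L : {set 'I_m}) (i j : 'I_m).

Definition ksign i L : K := (-1) ^+ #|[set j in L | (j < i)%N]|.

Definition koszul_diff k w : form :=
  [ffun L : {set 'I_m} =>
     \sum_(i in L | (i < k)%N) ksign i L *: wD W i (w (L :\ i))].

(** The complex in the first [k] variables is cut out of the full space of forms by a support
    condition, so the ambient type does not change when a variable is peeled off. *)
Definition kcond k (p : int) J := (#|J|%:Z == p) && [forall i in J, (i < k)%N].

Definition kform k (Z : set N) (p : int) : set form :=
  fun w => forall J, if kcond k p J then Z (w J) else w J = 0.

Definition pointwise (f : N -> N) w : form := [ffun J => f (w J)].

Lemma koszul_diff_linear k a u v :
  koszul_diff k (a *: u + v) = a *: koszul_diff k u + koszul_diff k v.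
Proof.
apply/ffunP => L; rewrite !ffunE scaler_sumr -big_split; apply: eq_bigr => i _ /=.
by rewrite !ffunE linearP scalerDr !scalerA mulrC.
Qed.

HB.instance Definition _ k :=
  GRing.isLinear.Build K form form _ (koszul_diff k) (koszul_diff_linear k).

Lemma pointwise_linear (f : {linear N -> N}) a u v :
  pointwise f (a *: u + v) = a *: pointwise f u + pointwise f v.
Proof. by apply/ffunP => L; rewrite !ffunE linearP. Qed.

HB.instance Definition _ (f : {linear N -> N}) :=
  GRing.isLinear.Build K form form _ (pointwise f) (pointwise_linear f).

Lemma koszul_diff_pointwise k i w :
  koszul_diff k (pointwise (wD W i) w) = pointwise (wD W i) (koszul_diff k w).
Proof.
apply/ffunP => L; rewrite !ffunE linear_sum; apply: eq_bigr => j _ /=.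
by rewrite !ffunE linearZ /= (wDD W i j).
Qed.

Lemma ksignK i L (x : N) : ksign i L *: (ksign i L *: x) = x.
Proof. by rewrite scalerA -expr2 sqrr_sign scale1r. Qed.

Lemma ksignD1_le i j L : (j <= i)%N -> ksign j (L :\ i) = ksign j L.
Proof.
move=> ji; congr (_ ^+ _); apply: eq_card => l; rewrite !inE.
by case: eqVneq => //= ->; rewrite ltnNge ji andbF.
Qed.

Lemma ksignD1_gt i j L : j \in L -> (j < i)%N -> ksign i (L :\ j) = - ksign i L.
Proof.
move=> jL ji; rewrite /ksign [in RHS](cardsD1 j) !inE jL ji exprS mulN1r opprK.
by congr (_ ^+ _); apply: eq_card => l; rewrite !inE andbA.
Qed.

(* (a, b) |-> a + (+/-) e_i /\ b; the sign puts e_i at its place in the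
   exterior products. *)
Definition glue i (u : form * form) : form :=
  [ffun J : {set 'I_m} => if i \in J then ksign i J *: u.2 (J :\ i) else u.1 J].

Definition unglue i w : form * form :=
  ([ffun J : {set 'I_m} => if i \in J then 0 else w J],
   [ffun J : {set 'I_m} => if i \in J then 0 else ksign i J *: w (i |: J)]).

Lemma glue_linear i a u v : glue i (a *: u + v) = a *: glue i u + glue i v.
Proof.
apply/ffunP => J; rewrite !ffunE /=; case: ifP => _ //; rewrite ?ffunE //=.
by rewrite scalerDr !scalerA mulrC.
Qed.

HB.instance Definition _ i :=
  GRing.isLinear.Build K (form * form)%type form _ (glue i) (glue_linear i).

Lemma unglueK i w : glue i (unglue i w) = w.
Proof.
apply/ffunP => J; rewrite !ffunE /=; case: ifP => iJ //; rewrite ?ffunE ?iJ //=.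
by rewrite setD11 ksignD1_le // ksignK finset.setD1K.
Qed.

(** Forms are split by whether e_i occurs. Since i is the last index, removing it from L alters no
    sign of a smaller index, while removing some j < i flips [ksign i L]: this is the minus sign of
    the cone. *)
Lemma koszul_diff_glue i u : koszul_diff i.+1 (glue i u) =
  glue i (cone_d (koszul_diff i) (pointwise (wD W i)) u).
Proof.
apply/ffunP => L; rewrite !ffunE /=; case: ifP => iL.
  rewrite (bigD1 i) ?iL ?ltnSn //= !ffunE setD11 scalerBr; congr (_ + _).
  rewrite scaler_sumr -sumrN; apply: eq_big => j.
    rewrite !inE -val_eqE /= ltnS ltn_neqAle.
    by case: (_ \in _); case: (_ == _); case: (_ <= _)%N.
  case/andP => /andP[jL lt_ji] ji; rewrite !ffunE !inE iL andbT eq_sym ji.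
  have {}ji : (j < i)%N by rewrite ltn_neqAle -ltnS lt_ji andbT.
  rewrite (@ksignD1_gt i j) // ksignD1_le ?(ltnW ji) // scaleNr.
  rewrite linearN /= linearZ /= scalerN.
  by rewrite !scalerA mulrC finset.setDDl finset.setUC -finset.setDDl.
apply: eq_big => j; last first.
  case/andP => jL _; rewrite !ffunE !inE iL andbF //.
rewrite ltnS leq_eqVlt; case: (eqVneq j i) => [->|ji]; first by rewrite iL.
by rewrite (negbTE ji : (_ == _ :> nat) = _).
Qed.

(** Through [glue] the differential is that of a cone, whose square vanishes by induction and
    commutation of the derivations; this replaces the usual double sum of signs. *)
Lemma koszul_diff_koszul_diff k w : (k <= m)%N -> koszul_diff k (koszul_diff k w) = 0.
Proof.
elim: k w => [|k IHk] w km.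
  by apply/ffunP => L; rewrite !ffunE big1 // => i; rewrite andbF.
have {}IHk := IHk ^~ (ltnW km); pose i := Ordinal km.
rewrite -(unglueK i w) !(koszul_diff_glue i) /cone_d /= linearB /= !IHk.
by rewrite koszul_diff_pointwise subr0 subrr (linear0 (glue i)).
Qed.

Definition stable_D k (Z : set N) := forall i z, (i < k)%N -> Z z -> Z (wD W i z).

Lemma subspace_kform k Z p : is_subspace Z -> is_subspace (kform k Z p).
Proof.
move=> sZ; split=> [J|a u v Zu Zv J]; rewrite !ffunE.
  by case: ifP => // _; apply: subspace0.
have := Zu J; have := Zv J; case: ifP => _; first by move=> *; apply: sZ.2.
by move=> -> ->; rewrite scaler0 addr0.
Qed.

Lemma kform_koszul_diff k Z p w : is_subspace Z -> stable_D k Z ->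
  kform k Z p w -> kform k Z (p + 1) (koszul_diff k w).
Proof.
move=> sZ DZ Zw J; rewrite ffunE; case: ifP => Jk.
  apply: subspace_sum => // i /andP[iJ ik]; apply: subspaceZ => //; apply: DZ => //.
  by have := Zw (J :\ i); case: ifP => // _ ->; apply: subspace0.
rewrite big1 // => i /andP[iJ ik]; have := Zw (J :\ i); rewrite ifN => [->|].
  by rewrite linear0 scaler0.
apply/negP => /andP[/eqP cJ /forall_inP kJ]; move: Jk; rewrite /kcond.
rewrite (cardsD1 i J) iJ addnC PoszD cJ eqxx; case: forall_inP => // -[] j jJ.
by case: (eqVneq j i) => [->//|ji]; apply: kJ; rewrite !inE ji.
Qed.

Lemma koszul_complex k Z B : (k <= m)%N -> is_subspace Z -> is_subspace B ->
  (B `<=` Z)%classic -> stable_D k Z -> stable_D k B ->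
  subquot_complex (koszul_diff k) (kform k Z) (kform k B).
Proof.
move=> km sZ sB BZ DZ DB; split=> [p|p|p z Bz J|p z|p z|z].
- exact: subspace_kform.
- exact: subspace_kform.
- by have := Bz J; case: ifP => // _; apply: BZ.
- exact: kform_koszul_diff.
- exact: kform_koszul_diff.
- exact: koszul_diff_koszul_diff.
Qed.

Lemma kcond_notin i p J : i \notin J -> kcond i.+1 p J = kcond i p J.
Proof.
move=> iJ; congr (_ && _); apply: eq_forallb_in => j jJ; rewrite ltnS ltn_neqAle.
by rewrite (_ : _ != _) //; apply: contraNneq iJ => /val_inj <-.
Qed.

Lemma kcond_in i p J : i \in J -> kcond i p J = false.
Proof. by move=> iJ; apply/andP => -[_ /forall_inP/(_ _ iJ)]; rewrite ltnn. Qed.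

Lemma kcond_setD1 i p J : i \in J -> kcond i.+1 p J = kcond i (p - 1) (J :\ i).
Proof.
move=> iJ; congr (_ && _).
  by rewrite (cardsD1 i J) iJ PoszD addrC eq_sym -subr_eq eq_sym.
apply/forall_inP/forall_inP => H j.
  by rewrite !inE => /andP[ji /H]; rewrite ltnS ltn_neqAle ji.
move=> jJ; case: (eqVneq j i) => [->//|ji]; rewrite ltnS ltnW // H //.
by rewrite !inE ji.
Qed.

Lemma kform_glue i Z p u : is_subspace Z ->
  coneS (kform i Z) p u -> kform i.+1 Z p (glue i u).
Proof.
move=> sZ [Z1 Z2] J; rewrite ffunE; case: (boolP (i \in J)) => iJ.
  rewrite kcond_setD1 //; have := Z2 (J :\ i); case: ifP => _.
    exact: subspaceZ.
  by move=> ->; rewrite scaler0.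
by rewrite kcond_notin //; apply: Z1.
Qed.

Lemma kform_unglue i Z p w : is_subspace Z ->
  kform i.+1 Z p w -> coneS (kform i Z) p (unglue i w).
Proof.
move=> sZ Zw; split=> J; rewrite ffunE; case: (boolP (i \in J)) => iJ.
- by rewrite kcond_in.
- by rewrite -kcond_notin //; apply: Zw.
- by rewrite kcond_in.
- have := Zw (i |: J); rewrite kcond_setD1 ?setU11 // finset.setU1K //.
  by case: ifP => _; [apply: subspaceZ|move=> ->; rewrite scaler0].
Qed.

Lemma glueK i Z p u : coneS (kform i Z) p u -> unglue i (glue i u) = u.
Proof.
case: u => a b [/= Za Zb]; congr pair; apply/ffunP => J; rewrite !ffunE /=.
  by case: (boolP (i \in J)) => // iJ; have := Za J; rewrite kcond_in.
case: (boolP (i \in J)) => iJ; first by have := Zb J; rewrite kcond_in.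
rewrite setU11 finset.setU1K // -{1}(finset.setU1K iJ).
by rewrite ksignD1_le // ksignK.
Qed.

Lemma kform_ker i k Z B :
  kform k (subker (wD W i) Z B) =
  kerZ (pointwise (wD W i)) (kform k Z) (kform k B).
Proof.
apply/funext => p; apply/seteqP; split=> w.
  move=> H; split=> J; have := H J; rewrite ?ffunE; case: ifP => _ //; first by case.
    by case.
  by move=> ->; rewrite linear0.
move=> [Zw Bw] J; have := Zw J; have := Bw J; rewrite ffunE.
by case: ifP.
Qed.

Lemma kform_coker i k Z B :
  kform k (subcoker (wD W i) Z B) =
  cokerB (pointwise (wD W i)) (kform k Z) (kform k B).
Proof.
apply/funext => p; apply/seteqP; split=> w.
  move=> H; split.
    by move=> J; have := H J; case: ifP => // _ [].
  have /choice[y yP] : forall J, exists y : N, if kcond k p J then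
      Z y /\ B (w J - wD W i y) else w J = 0 /\ y = 0.
    move=> J; have := H J; case: ifP => _; last by exists 0.
    by move=> [_ [y Zy By]]; exists y.
  exists [ffun J => y J] => J; have := yP J; rewrite !ffunE; case: ifP => _.
  - by case.
  - by case.
  - by case.
  - by case=> -> ->; rewrite linear0 subr0.
move=> [Zw [y Zy By]] J; have := Zw J; have := By J; have := Zy J.
rewrite !ffunE; case: ifP => // _ ZyJ ByJ ZJ; split=> //; by exists (y J).
Qed.

Lemma koszul_cone_dim i Z B p r : is_subspace Z -> is_subspace B ->
  (B `<=` Z)%classic -> stable_D i.+1 Z -> stable_D i.+1 B ->
  has_quot_dim
    (cocycles (cone_d (koszul_diff i) (pointwise (wD W i)))
       (coneS (kform i Z)) (coneS (kform i B)) p)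
    (coboundaries (cone_d (koszul_diff i) (pointwise (wD W i)))
       (coneS (kform i Z)) (coneS (kform i B)) p) r ->
  has_quot_dim (cocycles (koszul_diff i.+1) (kform i.+1 Z) (kform i.+1 B) p)
    (coboundaries (koszul_diff i.+1) (kform i.+1 Z) (kform i.+1 B) p) r.
Proof.
move=> sZ sB BZ DZ DB; have im := ltn_ord i.
have DZ' : stable_D i Z by move=> j z ji; apply: DZ; apply: ltnW.
have DB' : stable_D i B by move=> j z ji; apply: DB; apply: ltnW.
have C := koszul_complex (ltnW im) sZ sB BZ DZ' DB'.
have C1 := koszul_complex im sZ sB BZ DZ DB.
have pointZ U q z : stable_D i.+1 U -> kform i U q z ->
    kform i U q (pointwise (wD W i) z).
  move=> DU Uz J; rewrite ffunE; have := Uz J; case: ifP => _; first exact: DU.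
  by move=> ->; rewrite linear0.
have Cc := complex_cone C (fun q z => @pointZ Z q z DZ) (fun q z => @pointZ B q z DB)
  (@koszul_diff_pointwise i i).
apply: (has_quot_dim_rel (R := fun u w => w = glue i u)).
- exact: subspace_cocycles Cc.
- exact: subspace_cocycles C1.
- by rewrite linear0.
- by move=> a u v u' v' -> ->; rewrite linearP.
- move=> u [Zu Bu]; exists (glue i u) => //; split; first exact: kform_glue.
  by rewrite koszul_diff_glue; apply: kform_glue.
- move=> w [Zw Bw]; exists (unglue i w); last by rewrite unglueK.
  have Zu := kform_unglue sZ Zw; split=> //.
  have Zdu := sc_dZ Cc Zu; rewrite -(glueK Zdu) -koszul_diff_glue unglueK.
  exact: kform_unglue.
- move=> u _ [Zu _] _ ->; split=> -[_ [y Zy By]]; split=> //.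
  + exact: kform_glue.
  + exists (glue i y); first exact: kform_glue.
    by rewrite koszul_diff_glue -linearB; apply: kform_glue.
  + exists (unglue i y); first exact: kform_unglue.
    have Zy' := kform_unglue sZ Zy.
    have Zd : coneS (kform i Z) p
        (u - cone_d (koszul_diff i) (pointwise (wD W i)) (unglue i y)).
      by apply: subspaceB; [apply: (sc_Z Cc)| |have := sc_dZ Cc Zy'; rewrite subrK].
    rewrite -(glueK Zd) linearB /= -koszul_diff_glue unglueK.
    exact: kform_unglue.
Qed.

End PartialKoszul.

(** * Growth of subquotients *)

Lemma alternating_sum_telescope (r : int -> nat) k :
  \sum_(p < k) (-1) ^+ p * ((r p)%:Z + (r (p%:Z - 1))%:Z) =
  (r (- 1))%:Z - (-1) ^+ k * (r (k%:Z - 1))%:Z.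
Proof.
elim: k => [|k IHk]; first by rewrite big_ord0 expr0 mul1r sub0r subrr.
rewrite big_ord_recr /= IHk exprS (_ : k.+1%:Z - 1 = k); first by ring.
by lia.
Qed.

(** Meant for (t+1) r independent vectors in step 2t of the filtration: dividing by t+1 lowers the
    exponent, and 2t+1 <= 2(t+1) gives the factor [2 ^ k.+1]. *)
Lemma growth_arith C k r t : (t.+1 * r <= C * (t + t).+1 ^ k.+1 ->
  r <= C * 2 ^ k.+1 * t.+1 ^ k)%N.
Proof.
move=> le1; rewrite -(leq_pmul2l (ltn0Sn t)) (leq_trans le1) //.
have -> : (t.+1 * (C * 2 ^ k.+1 * t.+1 ^ k) = C * (2 * t.+1) ^ k.+1)%N.
  by rewrite expnMn (expnS t.+1); ring.
by rewrite leq_mul2l leq_exp2r //; lia.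
Qed.

Section IterLinear.
Variables (K : fieldType) (V : lmodType K) (f : {linear V -> V}) (l : nat).

Lemma iter_linearP a u v : iter l f (a *: u + v) = a *: iter l f u + iter l f v.
Proof. by elim: l => //= k ->; rewrite linearP. Qed.

Lemma iter_linear0 : iter l f 0 = 0.
Proof. by elim: l => //= k ->; rewrite linear0. Qed.

Lemma iter_linearZ a u : iter l f (a *: u) = a *: iter l f u.
Proof. by rewrite -[a *: u]addr0 iter_linearP iter_linear0 addr0. Qed.

Lemma iter_linearD u v : iter l f (u + v) = iter l f u + iter l f v.
Proof. by rewrite -[u]scale1r iter_linearP !scale1r. Qed.

Lemma iter_linearB u v : iter l f (u - v) = iter l f u - iter l f v.
Proof. by rewrite iter_linearD -!scaleN1r iter_linearZ. Qed.

Lemma iter_linear_sum (I : Type) (r : seq I) (P : pred I) (F : I -> V) :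
  iter l f (\sum_(i <- r | P i) F i) = \sum_(i <- r | P i) iter l f (F i).
Proof.
exact: (big_morph (iter l f) iter_linearD iter_linear0).
Qed.

End IterLinear.

Section WeylSubquotients.
Variables (K : fieldType) (m : nat) (N : lmodType K) (W : weyl_module m N).
Implicit Types (i : 'I_m) (Z B : set N).

(** The relation [D, X^l] = l X^(l-1). At [l = 0] the truncated predecessor is harmless, its
    coefficient being 0. *)
Lemma wD_iter_wX i l z : wD W i (iter l (wX W i) z) =
  iter l (wX W i) (wD W i z) + l%:R *: iter l.-1 (wX W i) z.
Proof.
elim: l z => [|l IHl] z; first by rewrite scale0r addr0.
have := wDX W i i (iter l (wX W i) z); rewrite eqxx scale1r => /(canRL (subrK _)).
rewrite !iterS => ->; rewrite IHl linearD linearZ /= addrC -addrA; congr (_ + _).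
case: l {IHl} => [|l]; first by rewrite scale0r add0r scale1r.
by rewrite [l.+2%:R]mulrSr scalerDl scale1r.
Qed.

Lemma iter_wD_wX i l z : iter l (wD W i) (wX W i z) =
  wX W i (iter l (wD W i) z) + l%:R *: iter l.-1 (wD W i) z.
Proof.
elim: l z => [|l IHl] z; first by rewrite scale0r addr0.
rewrite !iterS IHl linearD linearZ /=.
have := wDX W i i (iter l (wD W i) z); rewrite eqxx scale1r => /(canRL (subrK _)) ->.
rewrite [_ + wX _ _ _]addrC -addrA; congr (_ + _).
case: l {IHl} => [|l]; first by rewrite scale0r addr0 scale1r.
by rewrite [l.+2%:R]mulrS scalerDl scale1r.
Qed.

(** Restricted to the first [k] variables because in general neither the kernel nor the image of a
    derivation is stable under the matching X. *)
Definition weyl_stable k Z :=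
  forall i z, (i < k)%N -> Z z -> Z (wX W i z) /\ Z (wD W i z).

Variable G : nat -> set N.

(** Sizes of free families make sense before any dimension is known to be finite. Using [t.+1] keeps
    the bound usable at [t = 0]; for [k = 0] it is independent of t. *)
Definition growth k Z B := exists C, forall t r (e : 'I_r -> N),
  (forall x : 'I_r, Z (e x) /\ G t (e x)) -> qfree B e -> (r <= C * t.+1 ^ k)%N.

Record weyl_subquot k Z B : Prop := WeylSubquot {
  ws_Z : is_subspace Z;
  ws_B : is_subspace B;
  ws_BZ : (B `<=` Z)%classic;
  ws_stZ : weyl_stable k Z;
  ws_stB : weyl_stable k B;
  ws_growth : growth k Z B }.

Lemma growth_fin k Z B : growth k Z B -> exists C, forall t (T : finType) (e : T -> N),
  (forall x, Z (e x) /\ G t (e x)) ->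
  (forall c : T -> K, B (\sum_x c x *: e x) -> forall x, c x = 0) ->
  (#|T| <= C * t.+1 ^ k)%N.
Proof.
move=> [C gr]; exists C => t T e Ze fre; apply: gr (fun x => Ze (enum_val x)) _.
move=> c; rewrite (reindex _ (onW_bij _ (enum_rank_bij T))) /=.
under eq_bigr => x _ do rewrite enum_rankK.
by move=> /(fre (c \o enum_rank)) c0 x; rewrite -(enum_valK x); apply: c0.
Qed.

Hypothesis charK0 : [pchar K] =i pred0.
Hypothesis GX : forall i t z, G t z -> G t.+1 (wX W i z).
Hypothesis GD : forall i t z, G t z -> G t.+1 (wD W i z).
Hypothesis GS : forall t z, G t z -> G t.+1 z.
Hypothesis GE : forall z, exists t, G t z.

Let nat_neq0 l : l.+1%:R != 0 :> K.
Proof. by have /pcharf0P -> := charK0. Qed.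

Let stable_iter (f : N -> N) Z : (forall z, Z z -> Z (f z)) ->
  forall l z, Z z -> Z (iter l f z).
Proof. by move=> fZ; elim=> //= l IHl z Zz; apply/fZ/IHl. Qed.

Lemma filtration_le s t z : (s <= t)%N -> G s z -> G t z.
Proof. by move=> /subnK <-; elim: (t - s)%N => // k IHk Gz; apply/GS/IHk. Qed.

Let G_iter (f : N -> N) : (forall t z, G t z -> G t.+1 (f z)) ->
  forall l t z, (l <= t)%N -> G t z -> G (t + t)%N (iter l f z).
Proof.
move=> Gf l t z lt Gz; apply: (@filtration_le (l + t)); first by rewrite leq_add2r.
by elim: l {lt} => //= l; apply: Gf.
Qed.

(** Applying D_i to the sum of the X_i^l y_l, where D_i y_l is in [B], leaves modulo [B] the sum of
    the X_i^l (l+1) y_(l+1), which is one term shorter. Induction puts y_1, y_2, ... in [B], and y_0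
    follows by subtraction. *)
Lemma sum_iter_wX_sub i Z B k (y : nat -> N) : weyl_subquot i.+1 Z B ->
  (forall l, subker (wD W i) Z B (y l)) ->
  B (\sum_(l < k) iter l (wX W i) (y l)) -> forall l, (l < k)%N -> B (y l).
Proof.
move=> S; have sB := ws_B S.
have XB z : B z -> B (wX W i z) by case/(ws_stB S (ltnSn i)).
have DB z : B z -> B (wD W i z) by case/(ws_stB S (ltnSn i)).
elim: k y => // k IHk y Ky By.
have By1 l : (l < k)%N -> B (y l.+1).
  move=> lk; apply: (subspaceZr sB (nat_neq0 l)).
  apply: (IHk (fun l => l.+1%:R *: y l.+1)) lk => [{}l|].
    by apply: subspaceZ => //; apply: subspace_subker => //; case: S.
  have := DB _ By; rewrite linear_sum /=.
  under eq_bigr => j _ do rewrite wD_iter_wX.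
  rewrite big_split /=.
  have B1 : B (\sum_(j < k.+1) iter j (wX W i) (wD W i (y j))).
    by apply: subspace_sum => // j _; apply: stable_iter => //; case: (Ky j).
  move=> /(subspaceB sB) /(_ B1); rewrite addrAC subrr add0r.
  rewrite big_ord_recl /= scale0r add0r; congr (B _); apply: eq_bigr => j _.
  by rewrite iter_linearZ.
case=> [_|l]; last exact: By1.
move: By; rewrite big_ord_recl /= => By0.
rewrite -[y 0%N](addrK (\sum_(j < k) wX W i (iter j (wX W i) (y j.+1)))).
apply: subspaceB => //; apply: subspace_sum => // j _.
by apply: (stable_iter XB j.+1); apply: By1.
Qed.

Lemma growth_subker i Z B : weyl_subquot i.+1 Z B -> growth i (subker (wD W i) Z B) B.
Proof.
move=> S; have [C gr] := growth_fin (ws_growth S); have sB := ws_B S.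
have XZ z : Z z -> Z (wX W i z) by case/(ws_stZ S (ltnSn i)).
have sK : is_subspace (subker (wD W i) Z B) by apply: subspace_subker; case: S.
exists (C * 2 ^ i.+1)%N => t r e Ke fre.
(* The X_i^a e_b with a <= t stay in step 2t of the filtration, and there are (t+1) r of them. *)
have := gr (t + t)%N ('I_t.+1 * 'I_r)%type (fun x => iter x.1 (wX W i) (e x.2)).
rewrite card_prod !card_ord => bnd.
suff : (t.+1 * r <= C * (t + t).+1 ^ i.+1)%N.
  exact: growth_arith.
apply: bnd => [[a b]|c Bc [a b]] /=.
  have [[Zb _] Gb] := Ke b; split; first exact: stable_iter.
  by apply: G_iter => //; [apply: GX|rewrite -ltnS].
pose y l := \sum_(j < r) c (inord l, j) *: e j.
suff /fre : B (y a) by rewrite inord_val; apply.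
apply: (@sum_iter_wX_sub i Z B t.+1) => // [l|].
  by apply: subspace_sum => // j _; apply: subspaceZ => //; case: (Ke j).
move: Bc; rewrite (eq_bigr (fun x => c (x.1, x.2) *: iter x.1 (wX W i) (e x.2))) => [|[]//].
  rewrite -(pair_bigA _ (fun a b => c (a, b) *: iter a (wX W i) (e b))) /=.
congr (B _); apply: eq_bigr => l _; rewrite iter_linear_sum.
by apply: eq_bigr => j _; rewrite iter_linearZ inord_val.
Qed.

(** For u = D_i X_i z - (l+1) z one has D_i^l u = X_i D_i^(l+1) z, which lies in [B], so by
    induction u is in the image of D_i modulo [B]. So is D_i X_i z, hence also (l+1) z. *)
Lemma iter_wD_subcoker i Z B l z : weyl_subquot i.+1 Z B ->
  Z z -> B (iter l (wD W i) z) -> subcoker (wD W i) Z B z.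
Proof.
move=> S; have sB := ws_B S; have sZ := ws_Z S.
have sQ : is_subspace (subcoker (wD W i) Z B) by apply: subspace_subcoker.
have XB y : B y -> B (wX W i y) by case/(ws_stB S (ltnSn i)).
have st y : Z y -> Z (wX W i y) /\ Z (wD W i y) by apply: (ws_stZ S).
elim: l z => [|l IHl] z Zz Bz.
  by split=> //; exists 0; [apply: subspace0|rewrite linear0 subr0].
have [ZX ZD] := st _ Zz.
have QDX : subcoker (wD W i) Z B (wD W i (wX W i z)).
  have ZDX := (st _ ZX).2; split=> //.
  by exists (wX W i z); rewrite ?subrr; last exact: subspace0.
apply: (subspaceZr sQ (nat_neq0 l)).
rewrite -[_ *: z](subKr (wD W i (wX W i z))); apply: subspaceB => //.
apply: IHl; first by apply: subspaceB => //; [case: QDX|apply: subspaceZ].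
rewrite iter_linearB iter_linearZ -iterSr iter_wD_wX /= addrK.
exact: XB.
Qed.

Lemma growth_subcoker i Z B : weyl_subquot i.+1 Z B -> growth i Z (subcoker (wD W i) Z B).
Proof.
move=> S; have [C gr] := growth_fin (ws_growth S); have sB := ws_B S.
have sZ := ws_Z S.
have DZ z : Z z -> Z (wD W i z) by case/(ws_stZ S (ltnSn i)).
have sQ : is_subspace (subcoker (wD W i) Z B) by apply: subspace_subcoker.
exists (C * 2 ^ i.+1)%N => t r e Ke fre.
have := gr (t + t)%N ('I_t.+1 * 'I_r)%type (fun x => iter x.1 (wD W i) (e x.2)).
rewrite card_prod !card_ord => bnd.
suff : (t.+1 * r <= C * (t + t).+1 ^ i.+1)%N.
  exact: growth_arith.
apply: bnd => [[a b]|c Bc] /=.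
  have [Zb Gb] := Ke b; split; first exact: stable_iter.
  by apply: G_iter => //; [apply: GD|rewrite -ltnS].
pose y l := \sum_(j < r) c (inord l, j) *: e j.
have Zy l : Z (y l) by apply: subspace_sum => // j _; apply: subspaceZ => //; case: (Ke j).
have {}Bc : B (\sum_(l < t.+1) iter l (wD W i) (y l)).
  move: Bc; rewrite (eq_bigr (fun x => c (x.1, x.2) *: iter x.1 (wD W i) (e x.2))) => [|[]//].
  rewrite -(pair_bigA _ (fun a b => c (a, b) *: iter a (wD W i) (e b))) /=.
  congr (B _); apply: eq_bigr => l _; rewrite iter_linear_sum.
  by apply: eq_bigr => j _; rewrite iter_linearZ inord_val.
suff c0 l : (l <= t)%N -> forall j, c (inord l, j) = 0.
  by case=> a b; rewrite -[a]inord_val c0 // -ltnS.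
(* Once the coefficients below l vanish, the relation says that D_i^l (y_l + D_i u) is in [B]. Then
   y_l is in the image of D_i modulo [B], and freeness of [e] in the cokernel applies. *)
elim/ltn_ind: l => l IHl lt; apply: fre.
have y0 k : (k < l)%N -> y k = 0.
  by move=> kl; apply: big1 => j _; rewrite IHl ?scale0r // ltnW // (leq_trans kl).
pose u := \sum_(k < t.+1 | (l < k)%N) iter (k - l).-1 (wD W i) (y k).
have Zu : Z u by apply: subspace_sum => // k _; apply: stable_iter.
have Bu : B (iter l (wD W i) (y l + wD W i u)).
  move: Bc; rewrite (bigD1 (inord l)) //= inordK ?ltnS // iter_linearD -iterSr.
  rewrite /u (iter_linear_sum (wD W i) l.+1); congr (B (_ + _)).
  rewrite big_mkcond [RHS]big_mkcond /=.
  apply: eq_bigr => k _; rewrite -val_eqE /= inordK ?ltnS //.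
  case: (ltngtP k l) => [kl|lk|//]; last first.
    by rewrite /= -iterD -iterS; congr (iter _ _ _); lia.
  by rewrite y0 // iter_linear0.
have ZDu := DZ _ Zu.
have Qyu : subcoker (wD W i) Z B (y l + wD W i u).
  by apply: iter_wD_subcoker S _ Bu; apply: subspaceD.
rewrite -/(y l) -[y l](addrK (wD W i u)); apply: subspaceB => //.
by split=> //; exists u; rewrite // subrr; apply: subspace0.
Qed.

End WeylSubquotients.

(** * Euler characteristics of partial Koszul complexes *)

Section KoszulChar.
Variables (K : fieldType) (m : nat) (N : lmodType K) (W : weyl_module m N).
Implicit Types (i : 'I_m) (Z B : set N).

(** A relation, because finite-dimensionality has to be asserted: [quot_dim] returns 0 on
    infinite-dimensional quotients. Vanishing outside degrees 0 to k is recorded for the degree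
    shift in the cone. *)
Definition koszul_char k Z B (x : int) := exists h : int -> nat,
  [/\ forall p, has_quot_dim (cocycles (koszul_diff W k) (kform k Z) (kform k B) p)
        (coboundaries (koszul_diff W k) (kform k Z) (kform k B) p) (h p),
      forall p, ~~ (0 <= p <= k%:Z) -> h p = 0%N
    & \sum_(p < k.+1) (-1) ^+ p * (h p%:Z)%:Z = x].

Lemma koszul_char0 Z B r : is_subspace Z -> is_subspace B -> (B `<=` Z)%classic ->
  has_quot_dim Z B r -> koszul_char 0 Z B r%:Z.
Proof.
move=> sZ sB BZ hr.
have d0 w : koszul_diff W 0 w = 0.
  by apply/ffunP => L; rewrite !ffunE big1 // => i; rewrite andbF.
have kcondE p (J : {set 'I_m}) : kcond 0 p J = (p == 0) && (J == finset.set0).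
  apply/andP/andP => [[/eqP <-] /forall_inP J0|[/eqP -> /eqP ->]].
    rewrite eqz_nat cards_eq0; have -> // : J == finset.set0.
    by apply/eqP/setP => j; rewrite inE; apply/negP => /J0.
  by rewrite cards0; split=> //; apply/forall_inP => j; rewrite inE.
have C : subquot_complex (koszul_diff W 0) (kform 0 Z) (kform 0 B).
  by apply: koszul_complex.
exists (fun p => if p == 0 then r else 0%N); split=> [p|p|]; last first.
- by rewrite big_ord_recl big_ord0 expr0 mul1r addr0.
- by case: eqP => [->|].
case: eqP => [->|/eqP p0]; last first.
  exists (fun=> 0); split=> [[]//|w [Zw _]|c _ []//].
  exists (fun=> 0); rewrite big_ord0 subr0; split.
    by move=> J; have := Zw J; rewrite kcondE (negbTE p0).
  exists 0; first exact: subspace0 (sc_Z C _).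
  by rewrite d0 subr0 => J; have := Zw J; rewrite kcondE (negbTE p0).
have form0 (w : {ffun {set 'I_m} -> N}) : kform 0 Z 0 w ->
    w = [ffun J => if J == finset.set0 then w finset.set0 else 0].
  move=> Zw; apply/ffunP => J; rewrite ffunE; have := Zw J; rewrite kcondE eqxx /=.
  by case: eqP => [->|].
have kform0 (U : set N) z :
    kform 0 U 0 [ffun J : {set 'I_m} => if J == finset.set0 then z else 0] <-> U z.
  split=> [/(_ finset.set0)|Uz J]; rewrite kcondE !ffunE !eqxx //=.
  by case: (J == _).
apply: (has_quot_dim_rel (R := fun z w =>
  w = [ffun J : {set 'I_m} => if J == finset.set0 then z else 0]) _ _ _ _ _ _ _ hr) => //.
- exact: subspace_cocycles C.
- by apply/ffunP => J; rewrite !ffunE if_same.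
- move=> a u v _ _ -> ->; apply/ffunP => J; rewrite !ffunE.
  by case: ifP; rewrite // scaler0 addr0.
- move=> z Zz; eexists; last by []; split; first exact/kform0.
  by rewrite d0; apply: subspace0 (sc_B C _).
- move=> w [Zw _]; exists (w finset.set0); last exact: form0.
  by have := Zw finset.set0; rewrite kcondE !eqxx.
- move=> z _ Zz _ ->; split=> [Bz|[_ [y _]]]; last by rewrite d0 subr0 => /kform0.
  split; first exact/kform0.
  by exists 0; [apply: subspace0 (sc_Z C _)|rewrite d0 subr0; apply/kform0].
Qed.

(** The cokernel contributes one degree higher in the cone, whence the minus sign; each connecting
    rank occurs in two consecutive degrees, so the ranks telescope away. *)
Lemma koszul_char_succ i Z B x y : is_subspace Z -> is_subspace B ->
  (B `<=` Z)%classic -> stable_D W i.+1 Z -> stable_D W i.+1 B ->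
  koszul_char i (subker (wD W i) Z B) B x -> koszul_char i Z (subcoker (wD W i) Z B) y ->
  koszul_char i.+1 Z B (x - y).
Proof.
move=> sZ sB BZ DZ DB [hK [dimK K0 <-]] [hQ [dimQ Q0 <-]].
have DZ' : stable_D W i Z by move=> j z ji; apply: DZ; apply: ltnW.
have DB' : stable_D W i B by move=> j z ji; apply: DB; apply: ltnW.
have C := koszul_complex (ltnW (ltn_ord i)) sZ sB BZ DZ' DB'.
have pointZ U q (z : {ffun {set 'I_m} -> N}) : stable_D W i.+1 U ->
    kform i U q z -> kform i U q (pointwise (wD W i) z).
  move=> DU Uz J; rewrite ffunE; have := Uz J; case: ifP => _; first exact: DU.
  by move=> ->; rewrite linear0.
rewrite kform_ker // in dimK; rewrite kform_coker // in dimQ.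
have [h [r [dimh hr]]] := cone_dims C (fun q z => @pointZ Z q z DZ)
  (fun q z => @pointZ B q z DB) (@koszul_diff_pointwise _ _ _ W i i) dimK dimQ.
have r0 p : p < 0 \/ i.+1%:Z <= p -> r p = 0%N.
  move=> p0; have [_ rQ rK] := hr p; apply/eqP; rewrite -leqn0.
  case: p0 => p0; first by rewrite -(Q0 (p - 1)) //; lia.
  by rewrite -(K0 (p + 1)) //; lia.
exists h; split=> [p|p p0|].
- exact: koszul_cone_dim (dimh p).
- by have [] := hr p; rewrite (K0 p) ?(Q0 (p - 1)); lia.
have hE (p : nat) :
    (h p)%:Z = ((hK p)%:Z + (hQ (p%:Z - 1))%:Z) - ((r p)%:Z + (r (p%:Z - 1))%:Z).
  by have [] := hr p; lia.
under eq_bigr => p _ do rewrite hE mulrBr.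
rewrite sumrB alternating_sum_telescope !r0 ?mulr0 ?subr0; [|lia|lia].
under eq_bigr => p _ do rewrite mulrDr.
rewrite big_split /=; congr (_ + _).
  by rewrite big_ord_recr /= K0 ?mulr0 ?addr0 //; lia.
rewrite big_ord_recl /= Q0 // mulr0 add0r -sumrN; apply: eq_bigr => p _.
by rewrite exprS mulN1r mulNr /bump /= (_ : (1 + p)%N%:Z - 1 = p) //; lia.
Qed.

End KoszulChar.

(** * Generalized eigenvalues and Fitting's lemma *)

Section GeneralizedEigenvalues.
Variables (K : fieldType) (V : lmodType K).
Implicit Types (f g T : {linear V -> V}) (Z B : set V) (s : seq K).

(** The polynomial with list of roots [s], evaluated at [f]. *)
Definition shift_prod (f : V -> V) s z := foldr (fun e w => f w - e *: w) z s.

(* The vectors of Z / B are sums of generalized eigenvectors of f of exponent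
   at most a, phrased by annihilators so as to pass to subquotients trivially. *)
Definition eigen_exponent a (f : V -> V) Z B := forall c z, Z z ->
  exists s, c \notin s /\ B (shift_prod f s (iter a (fun w => f w - c *: w) z)).

(** On [Z'] modulo [B'] the operator g is f + k, so annihilating polynomials of f serve for g once
    their roots are translated by k. It is g that preserves [Z'], so the induction follows g inside
    [Z'] and compares f with it modulo [B']. *)
Lemma eigen_exponent_shift a k f g Z B Z' B' :
  is_subspace Z' -> is_subspace B' -> (B `<=` B')%classic -> (Z' `<=` Z)%classic ->
  (forall z, Z' z -> Z' (g z)) -> (forall z, B' z -> B' (f z)) ->
  (forall z, Z' z -> B' (f z - g z + k *: z)) ->
  eigen_exponent a f Z B -> eigen_exponent a g Z' B'.
Proof.
move=> sZ sB BB ZZ gZ fB fg E c z Zz; have [s [cs Bs]] := E (c - k) z (ZZ _ Zz).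
exists [seq e + k | e <- s]; split.
  by apply: contra cs => /mapP[e es /eqP]; rewrite -subr_eq => /eqP ->.
have step u v e : Z' v -> B' (u - v) ->
    Z' (g v - (e + k) *: v) /\ B' ((f u - e *: u) - (g v - (e + k) *: v)).
  move=> Zv Buv; split; first by apply: subspaceB; [|apply: gZ|apply: subspaceZ].
  have Bfg : B' ((f v - e *: v) - (g v - (e + k) *: v)).
    rewrite opprB scalerDl -[_ + _ - g v]addrA subrKA addrA addrAC; exact: fg.
  have Bf : B' ((f u - e *: u) - (f v - e *: v)).
    rewrite opprD addrACA -opprD -linearB -scalerBr.
    by apply: subspaceB => //; [apply: fB|apply: subspaceZ].
  by have := subspaceD sB Bf Bfg; rewrite addrA subrK.
pose ss (h : V -> V) c l v := iter l (fun w => h w - c *: w) v.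
have iterP l : Z' (ss g c l z) /\ B' (ss f (c - k) l z - ss g c l z).
  elim: l => [|l [Zl Bl]]; first by rewrite subrr; split=> //; apply: subspace0.
  by have := step _ _ (c - k) Zl Bl; rewrite subrK.
have prodP q : Z' (shift_prod g [seq e + k | e <- q] (ss g c a z)) /\
    B' (shift_prod f q (ss f (c - k) a z) - shift_prod g [seq e + k | e <- q] (ss g c a z)).
  by elim: q => [|e q [Zq Bq]]; [apply: iterP|apply: step].
have [_ Bfg] := prodP s; apply/(subspace_congr sB Bfg); exact: BB.
Qed.

(** A polynomial without the root 0 is a nonzero constant plus a multiple of the variable; [c] is
    that constant, the product of the -e. *)
Lemma shift_prodE T Z s z : is_subspace Z -> (forall z, Z z -> Z (T z)) ->
  0 \notin s -> Z z ->
  exists c y, [/\ c != 0, Z y & shift_prod T s z = c *: z + T y].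
Proof.
move=> sZ TZ; elim: s => [|e s IHs] s0 Zz.
  exists 1, 0; split; rewrite ?oner_eq0 //; first exact: subspace0.
  by rewrite linear0 addr0 scale1r.
move: s0; rewrite inE negb_or eq_sym => /andP[e0 /IHs/(_ Zz)[c [y [c0 Zy qE]]]].
exists (- e * c), (c *: z + T y - e *: y); split.
- by rewrite mulf_neq0 // oppr_eq0.
- apply: subspaceB => //; last exact: subspaceZ.
  by apply: subspaceD => //; [apply: subspaceZ|apply: TZ].
rewrite /= qE [in RHS]linearB [in RHS]linearZ /= scalerDr scalerA mulNr scaleNr.
by rewrite opprD [RHS]addrCA.
Qed.

Lemma shift_prod_iter T s l z : shift_prod T s (iter l T z) = iter l T (shift_prod T s z).
Proof.
elim: s => //= e s ->; rewrite iter_linearB iter_linearZ; congr (_ - _).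
by rewrite -iterS iterSr.
Qed.

(** On the kernel of [T] modulo [B] a polynomial in [T] acts as its constant term, here nonzero. *)
Lemma shift_prod_ker T B s u : is_subspace B -> (forall z, B z -> B (T z)) ->
  0 \notin s -> B (T u) -> B (shift_prod T s u) -> B u.
Proof.
move=> sB TB s0 BTu.
have [c c0 Bc] : exists2 c, c != 0 & B (shift_prod T s u - c *: u).
  elim: s s0 => [|e s IHs].
    by exists 1; rewrite ?oner_eq0 // scale1r subrr; apply: subspace0.
  rewrite inE negb_or eq_sym => /andP[e0 /IHs[c c0 Bc]].
  exists (- e * c); first by rewrite mulf_neq0 // oppr_eq0.
  rewrite /= (_ : _ - _ = T (shift_prod T s u - c *: u) + c *: T u
                          - e *: (shift_prod T s u - c *: u)).
    apply: subspaceB => //; last exact: subspaceZ.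
    by apply: subspaceD => //; [apply: TB|apply: subspaceZ].
  rewrite (linearB T) (linearZ_LR T) /= subrK scalerBr opprB mulNr scaleNr opprK scalerA.
  by rewrite addrA addrAC.
by move=> /(subspace_congr sB Bc) /(subspaceZr sB c0).
Qed.

(* Fitting: only the generalized kernel of T contributes to both sides, and it
   is finite-dimensional modulo B. *)
Lemma fitting_index a T Z B r t : is_subspace Z -> is_subspace B -> (B `<=` Z)%classic ->
  (forall z, Z z -> Z (T z)) -> (forall z, B z -> B (T z)) ->
  eigen_exponent a T Z B ->
  has_quot_dim (subker T Z B) B r -> has_quot_dim Z (subcoker T Z B) t -> r = t.
Proof.
move=> sZ sB BZ TZ TB E hr ht.
have {}E z : Z z -> exists s, 0 \notin s /\ B (shift_prod T s (iter a T z)).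
  move=> /(E 0)[q [q0 Bq]]; exists q; split=> //.
  by rewrite (eq_iter (f' := fun w => T w - 0 *: w)) // => w; rewrite scale0r subr0.
(* Modulo [B], [M l] is the kernel of T^l, and [imM l] below is the image of [M l] under T. *)
pose M l : set V := fun z => Z z /\ B (iter l T z).
have sM l : is_subspace (M l).
  split; first by split; rewrite ?iter_linear0; apply: subspace0.
  by move=> c u v [Zu Bu] [Zv Bv]; split; rewrite ?iter_linearP; [apply: sZ.2|apply: sB.2].
have sK := subspace_subker T sZ sB.
have BK : (B `<=` subker T Z B)%classic by move=> z Bz; split; [apply: BZ|apply: TB].
pose imM l : set V := fun w => Z w /\ exists2 y, M l y & B (w - T y).
have sim l : is_subspace (imM l).
  split.
    split; first exact: subspace0.
    by exists 0; rewrite ?(linear0 T) ?subr0; apply: subspace0.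
  move=> c u v [Zu [x Mx Bx]] [Zv [y My By]]; split; first exact: sZ.2.
  exists (c *: x + y); first exact: (sM _).2.
  by rewrite linearP opprD addrACA -scalerBr; apply: sB.2.
have Bim l : (B `<=` imM l)%classic.
  move=> z Bz; split; first exact: BZ.
  by exists 0; [apply: subspace0|rewrite linear0 subr0].
have KM l : (subker T Z B `<=` M l.+1)%classic.
  move=> z [Zz Bz]; split=> //; rewrite iterSr.
  by elim: l => //= l; apply: TB.
have dimMim l d : has_quot_dim (imM l.+1) B d -> has_quot_dim (M l.+1) (subker T Z B) d.
  apply: (has_quot_dim_rel (R := fun w y => B (w - T y))) => //.
  - by rewrite linear0 subr0; apply: subspace0.
  - by move=> c u v u' v' Ru Rv; rewrite linearP opprD addrACA -scalerBr; apply: sB.2.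
  - by move=> w [Zw [y My By]]; exists y.
  - move=> y My; exists (T y); last by rewrite subrr; apply: subspace0.
    split; first by case: My => /TZ.
    by exists y; rewrite // subrr; apply: subspace0.
  - by move=> w y _ [Zy _] Bwy; rewrite (subspace_congr sB Bwy); split=> [|[]].
have imM_M l : (imM l.+1 `<=` M l)%classic.
  move=> w [Zw [y [Zy By] Bwy]]; split=> //.
  rewrite -[w](subrK (T y)) iter_linearD -iterSr; apply: subspaceD => //.
  by elim: l {sM sim Bim KM dimMim By} => //= l; apply: TB.
(* Rank-nullity: T maps [M l.+1] into [M l] with a kernel of dimension r, so each step adds at most
   r. *)
have dimM l : exists d, has_quot_dim (M l) B d.
  elim: l => [|l [d hd]].
    exists 0%N, (fun=> 0); split=> [[]//|z [_ Bz]|c _ []//].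
    by exists (fun=> 0); rewrite big_ord0 subr0.
  have [_ [d' [_ hd' _]]] := has_quot_dim_split (sM l) (sim l.+1) sB (Bim _) (@imM_M l) hd.
  exists (d' + r)%N; exact: has_quot_dim_add (dimMim _ _ hd') hr.
(* The chain stops at a: T^a z is killed both by T and by a polynomial with nonzero constant
   term. *)
have MS z : M a.+1 z -> M a z.
  move=> [Zz Bz]; split=> //; have [q [q0 Bq]] := E z Zz.
  exact: (shift_prod_ker sB TB q0).
have MSE : M a.+1 = M a.
  apply/seteqP; split=> z; first exact: MS.
  by move=> [Zz Bz]; split=> //; apply: TB.
have [d hd] := dimM a.+1.
have imMM : (imM a.+1 `<=` M a.+1)%classic by rewrite MSE; apply: imM_M.
have [e [d' [he hd' dE]]] := has_quot_dim_split (sM _) (sim _) sB (Bim _) imMM hd.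
(* Two counts of the dimension of [M a.+1], through its image under T and through ker T, share the
   dimension of that image; what remains is r = e. *)
have dE' := has_quot_dim_uniq sB hd
  (has_quot_dim_add (sM _) sK sB BK (@KM a) (dimMim _ _ hd') hr).
have {dE dE'} -> : r = e by lia.
apply: has_quot_dim_uniq (subspace_subcoker T sZ sB) _ ht.
have sQ := subspace_subcoker T sZ sB.
apply: (has_quot_dim_rel (R := fun y z => subcoker T Z B (y - z)) _ _ _ _ _ _ _ he) => //.
- by rewrite subr0; apply: subspace0.
- by move=> c u v u' v' Ru Rv; rewrite opprD addrACA -scalerBr; apply: sQ.2.
- by move=> y [Zy _]; exists y; rewrite // subrr; apply: subspace0.
(* Surjectivity onto coker T: the polynomial with roots [q] sends z into [M a], and acts on it as a
   nonzero scalar modulo the image of T. *)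
- move=> z Zz; have [q [q0 Bq]] := E z Zz.
  have [c [y [c0 Zy qE]]] := shift_prodE sZ TZ q0 Zz.
  exists (c^-1 *: shift_prod T q z).
    rewrite MSE; split.
      rewrite qE; apply: subspaceZ => //.
      by apply: subspaceD => //; [apply: subspaceZ|apply: TZ].
    by rewrite iter_linearZ -shift_prod_iter; apply: subspaceZ.
  rewrite qE scalerDr scalerK // addrC addKr -linearZ.
  by apply: image_subcoker => //; apply: subspaceZ.
- move=> y z My Zz Ryz; rewrite -(subspace_congr sQ Ryz); split.
    by move=> [Zy [x [Zx _] Bx]]; split=> //; exists x.
  (* Injectivity: if T x = y modulo [B] with y in [M a], then T^(a+1) kills x, so x is itself in
     [M a]. *)
  move=> [Zy [x Zx Bx]]; split=> //; exists x => //; split=> //.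
  apply: (TB); suff: M a.+1 x by move=> /MS[].
  split=> //; rewrite iterSr -(subspace_congr sB (u := iter a T y)).
    by move: My; rewrite MSE => -[].
  rewrite -iter_linearB; elim: (a) => //= l; exact: TB.
Qed.

End GeneralizedEigenvalues.

(** * Vanishing of the Euler characteristic *)

Section Vanishing.
Variables (K : fieldType) (n : nat) (N : lmodType K) (W : weyl_module n.+1 N).
Implicit Types (i j : 'I_n.+1) (Z B : set N).

Definition euler_part k (z : N) : N := \sum_(i < n.+1 | (i < k)%N) wX W i (wD W i z).

Lemma euler_part_linear k a u v :
  euler_part k (a *: u + v) = a *: euler_part k u + euler_part k v.
Proof.
rewrite scaler_sumr -big_split; apply: eq_bigr => i _ /=.
by rewrite !linearP.
Qed.

HB.instance Definition _ k :=
  GRing.isLinear.Build K N N _ (euler_part k) (euler_part_linear k).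

Lemma euler_part_succ i z : euler_part i.+1 z = euler_part i z + wX W i (wD W i z).
Proof.
rewrite [LHS](bigD1 i) ?ltnSn //= addrC; congr (_ + _); apply: eq_bigl => j.
by rewrite ltnS ltn_neqAle andbC.
Qed.

Lemma euler_part_stable k Z z : is_subspace Z -> weyl_stable W k Z ->
  Z z -> Z (euler_part k z).
Proof.
move=> sZ st Zz; apply: subspace_sum => // i ik.
by case: (st i _ ik (st i z ik Zz).2).
Qed.

Lemma euler_part_wX k i z : (i < k)%N ->
  euler_part k (wX W i z) = wX W i (euler_part k z) + wX W i z.
Proof.
move=> ik; rewrite linear_sum.
transitivity (\sum_(j < n.+1 | (j < k)%N)
    (wX W i (wX W j (wD W j z)) + (j == i)%:R *: wX W i z)).
  apply: eq_bigr => j _; have := wDX W j i z => /(canRL (subrK _)) ->.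
  rewrite linearD linearZ /= wXX addrC; congr (_ + _).
  by case: eqP => [->|_]; rewrite // !scale0r.
rewrite big_split /=; congr (_ + _); rewrite (bigD1 i) //= eqxx scale1r.
by rewrite big1 ?addr0 // => j /andP[_ /negbTE->]; rewrite scale0r.
Qed.

Lemma euler_part_wD k i z : (i < k)%N ->
  euler_part k (wD W i z) = wD W i (euler_part k z) - wD W i z.
Proof.
move=> ik; apply/eqP; rewrite -subr_eq opprK eq_sym linear_sum; apply/eqP.
transitivity (\sum_(j < n.+1 | (j < k)%N)
    (wX W j (wD W j (wD W i z)) + (j == i)%:R *: wD W i z)).
  apply: eq_bigr => j _; have := wDX W i j (wD W j z) => /(canRL (subrK _)) ->.
  rewrite wDD addrC eq_sym; congr (_ + _).
  by case: eqP => [->|_]; rewrite // !scale0r.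
rewrite big_split /=; congr (_ + _); rewrite (bigD1 i) //= eqxx scale1r.
by rewrite big1 ?addr0 // => j /andP[_ /negbTE->]; rewrite scale0r.
Qed.

Lemma wD_wX_neq i j z : i != j -> wD W i (wX W j z) = wX W j (wD W i z).
Proof. by move=> ij; apply/eqP; rewrite -subr_eq0 wDX (negbTE ij) scale0r. Qed.

Lemma stable_subker i Z B : is_subspace Z -> is_subspace B ->
  weyl_stable W i.+1 Z -> weyl_stable W i.+1 B ->
  weyl_stable W i (subker (wD W i) Z B).
Proof.
move=> sZ sB stZ stB j z ji [Zz Bz]; have ne : i != j by rewrite neq_ltn ji orbT.
have ji1 : (j < i.+1)%N by apply: ltnW.
have [ZX ZD] := stZ j z ji1 Zz; have [BX BD] := stB j _ ji1 Bz.
by split; split; rewrite ?wD_wX_neq // wDD.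
Qed.

Lemma stable_subcoker i Z B : is_subspace Z -> is_subspace B ->
  weyl_stable W i.+1 Z -> weyl_stable W i.+1 B ->
  weyl_stable W i (subcoker (wD W i) Z B).
Proof.
move=> sZ sB stZ stB j z ji [Zz [y Zy Bzy]]; have ne : i != j by rewrite neq_ltn ji orbT.
have ji1 : (j < i.+1)%N by apply: ltnW.
have [ZX ZD] := stZ j z ji1 Zz; have [BX BD] := stB j _ ji1 Bzy.
have [ZXy ZDy] := stZ j y ji1 Zy.
split; split=> //; [exists (wX W j y)|exists (wD W j y)] => //.
  by rewrite wD_wX_neq // -linearB.
by rewrite wDD -linearB.
Qed.

Variable G : nat -> set N.
Hypothesis charK0 : [pchar K] =i pred0.
Hypothesis GX : forall i t z, G t z -> G t.+1 (wX W i z).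
Hypothesis GD : forall i t z, G t z -> G t.+1 (wD W i z).
Hypothesis GS : forall t z, G t z -> G t.+1 z.
Hypothesis GE : forall z, exists t, G t z.

Lemma weyl_subquot_ker i Z B : weyl_subquot W G i.+1 Z B ->
  weyl_subquot W G i (subker (wD W i) Z B) B.
Proof.
move=> S; have [sZ sB BZ stZ stB _] := S; split=> //.
- exact: subspace_subker.
- by move=> z Bz; split; [apply: BZ|case: (stB i z (ltnSn i) Bz)].
- exact: stable_subker.
- by move=> j z ji; apply: stB; apply: ltnW.
- exact: growth_subker.
Qed.

Lemma weyl_subquot_coker i Z B : weyl_subquot W G i.+1 Z B ->
  weyl_subquot W G i Z (subcoker (wD W i) Z B).
Proof.
move=> S; have [sZ sB BZ stZ stB _] := S; split=> //.
- exact: subspace_subcoker.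
- by move=> z [].
- by move=> j z ji; apply: stZ; apply: ltnW.
- exact: stable_subcoker.
- exact: growth_subcoker.
Qed.

Lemma weyl_subquot0_dim Z B : weyl_subquot W G 0 Z B -> exists r, has_quot_dim Z B r.
Proof.
move=> [sZ sB BZ _ _ [C gr]]; apply: (@bounded_has_quot_dim _ _ _ _ C) => // r e Ze fre.
have /choice[t Gt] := fun x => GE (e x).
have /(_ _) := gr (\sum_x t x)%N r e _ fre; rewrite expn0 muln1; apply=> x.
split=> //; apply: filtration_le (Gt x) => //.
by rewrite (bigD1 x) //= leq_addr.
Qed.

Variable Y : N -> N.
Hypothesis wXK : cancel (wX W ord0) Y.
Hypothesis YK : cancel Y (wX W ord0).

Lemma inverse_linear a u v : Y (a *: u + v) = a *: Y u + Y v.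
Proof. by apply: (can_inj wXK); rewrite YK linearP !YK. Qed.

HB.instance Definition _ := GRing.isLinear.Build K N N _ Y inverse_linear.

Lemma wD_inverse i z : i != ord0 -> wD W i (Y z) = Y (wD W i z).
Proof. by move=> i0; apply: (can_inj wXK); rewrite -wD_wX_neq // !YK. Qed.

Lemma koszul_char_base Z B a : weyl_subquot W G 1 Z B ->
  eigen_exponent a (euler_part 1) Z B ->
  (forall z, Z z -> Z (Y z)) -> (forall z, B z -> B (Y z)) ->
  koszul_char W 1 Z B 0.
Proof.
move=> S E ZY BY; have [sZ sB BZ stZ stB _] := S.
have [r hr] := weyl_subquot0_dim (@weyl_subquot_ker ord0 Z B S).
have [t ht] := weyl_subquot0_dim (@weyl_subquot_coker ord0 Z B S).
pose T := euler_part 1.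
have TE z : T z = wX W ord0 (wD W ord0 z).
  by rewrite (euler_part_succ ord0 z : T z = _) {1}/euler_part big1 ?add0r.
have hrT : has_quot_dim (subker T Z B) B r.
  suff -> : subker T Z B = subker (wD W ord0) Z B by [].
  apply/seteqP; split=> z [Zz Bz]; split=> //.
    by move: Bz; rewrite TE => /BY; rewrite wXK.
  by rewrite TE; case: (stB ord0 _ _ Bz).
(* Here the two denominators may differ as subspaces: X_0 carries D_0 Z + B onto T Z + B, with
   inverse [Y]. *)
have htT : has_quot_dim Z (subcoker T Z B) t.
  apply: (has_quot_dim_rel (R := fun z z' => z' = wX W ord0 z) _ _ _ _ _ _ _ ht) => //.
  - by rewrite linear0.
  - by move=> c u v _ _ -> ->; rewrite linearP.
  - by move=> z Zz; exists (wX W ord0 z) => //; case: (stZ ord0 z _ Zz).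
  - by move=> z Zz; exists (Y z); [apply: ZY|rewrite YK].
  - move=> z z' Zz Zz' e; rewrite e in Zz' *; split=> -[_ [y Zy By]]; split=> //; exists y => //.
      by rewrite TE -linearB; case: (stB ord0 _ _ By).
    by move: By; rewrite TE -linearB => /BY; rewrite /= wXK.
have rt : r = t.
  apply: (@fitting_index _ _ a T Z B) hrT htT => // z; first exact: euler_part_stable.
  exact: euler_part_stable.
have [stDZ stDB] : stable_D W 1 Z /\ stable_D W 1 B.
  by split=> i z i0 Uz; [case: (stZ i z i0 Uz)|case: (stB i z i0 Uz)].
rewrite -[0](subrr (r%:Z)) {2}rt; apply: (@koszul_char_succ _ _ _ W ord0) => //.
  apply: koszul_char0 => //; first exact: subspace_subker.
  by move=> z Bz; split; [apply: BZ|apply: stDB].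
by apply: koszul_char0 => //; [apply: subspace_subcoker|move=> z []].
Qed.

Lemma koszul_char_vanish k Z B a : (k < n.+1)%N -> weyl_subquot W G k.+1 Z B ->
  eigen_exponent a (euler_part k.+1) Z B ->
  (forall z, Z z -> Z (Y z)) -> (forall z, B z -> B (Y z)) ->
  koszul_char W k.+1 Z B 0.
Proof.
elim: k Z B => [|k IHk] Z B kn S E ZY BY; first exact: koszul_char_base S E ZY BY.
have [sZ sB BZ stZ stB _] := S; pose i : 'I_n.+1 := Ordinal kn.
have i0 : i != ord0 by [].
have [stDZ stDB] : stable_D W i.+1 Z /\ stable_D W i.+1 B.
  by split=> j z ji Uz; [case: (stZ j z ji Uz)|case: (stB j z ji Uz)].
have SK := @weyl_subquot_ker i Z B S; have SQ := @weyl_subquot_coker i Z B S.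
have fE z : euler_part i.+1 z - euler_part i z = wX W i (wD W i z).
  by rewrite euler_part_succ addrAC subrr add0r.
have eB z : B z -> B (euler_part i.+1 z) by apply: euler_part_stable.
rewrite -[0](subrr 0); apply: (@koszul_char_succ _ _ _ W i) => //.
  apply: IHk => //; first exact: ltnW.
    apply: (@eigen_exponent_shift _ _ a 0 (euler_part i.+1) (euler_part i) Z B) => //.
    - by case: SK.
    - by move=> z [].
    - by move=> z; apply: euler_part_stable; case: SK.
    - move=> z [_ Bz]; rewrite [X in X + _]fE scale0r addr0.
      by case: (stB i _ (ltnSn i) Bz).
  by move=> z [Zz Bz]; split; [apply: ZY|rewrite wD_inverse //; apply: BY].
have [_ sQ _ _ _ _] := SQ.
have BQ := sub_subcoker (wD W i) sZ BZ.
apply: IHk => //; first exact: ltnW.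
  apply: (@eigen_exponent_shift _ _ a 1 (euler_part i.+1) (euler_part i) Z B) => //.
  - by move=> z; apply: euler_part_stable; case: SQ.
  (* The Euler operator E preserves the image of D_i because E D_i y = D_i (E y - y). *)
  - move=> z [Zz [y Zy Bzy]]; rewrite -(subrK (wD W i y) z) (linearD (euler_part _)).
    apply: subspaceD => //; first by apply/BQ/eB.
    rewrite [X in subcoker _ _ _ X](euler_part_wD y (ltnSn i)) -linearB.
    apply: image_subcoker => //.
      by move=> u Zu; case: (stZ i u (ltnSn i) Zu).
    by apply: subspaceB => //; apply: euler_part_stable.
  (* X_i D_i + 1 = D_i X_i vanishes on the cokernel, which is why the shift is 1. *)
  - move=> z Zz; rewrite [X in X + _]fE scale1r.
    have := wDX W i i z; rewrite eqxx scale1r => /(canRL (subrK _)).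
    rewrite addrC => <-; apply: image_subcoker => //.
      by move=> u Zu; case: (stZ i u (ltnSn i) Zu).
    by case: (stZ i z (ltnSn i) Zz).
move=> z [Zz [y Zy Bzy]]; split; first exact: ZY.
by exists (Y y); [apply: ZY|rewrite wD_inverse // -linearB; apply: BY].
Qed.

End Vanishing.

(** * Consequences of the hypotheses on the module *)

Section ShiftProd.
Variables (K : fieldType) (V : lmodType K) (f : {linear V -> V}).
Implicit Types (s : seq K).

Lemma shift_prod_linear s a u v :
  shift_prod f s (a *: u + v) = a *: shift_prod f s u + shift_prod f s v.
Proof.
elim: s => //= e s ->; rewrite linearP scalerDr opprD addrACA scalerBr.
by rewrite !scalerA mulrC.
Qed.

HB.instance Definition _ s :=
  GRing.isLinear.Build K V V _ (shift_prod f s) (shift_prod_linear s).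

Lemma shift_prod_cat s t z : shift_prod f (s ++ t) z = shift_prod f s (shift_prod f t z).
Proof. exact: foldr_cat. Qed.

Lemma shift_prod_nseq a c z : iter a (fun w => f w - c *: w) z = shift_prod f (nseq a c) z.
Proof. by elim: a => //= a ->. Qed.

Lemma shift_prod_intertwine (h : {linear V -> V}) k s z :
  (forall z, f (h z) = h (f z) + k *: h z) ->
  shift_prod f [seq e + k | e <- s] (h z) = h (shift_prod f s z).
Proof.
move=> fh; elim: s => //= e s ->.
rewrite fh [RHS]linearB [in RHS]linearZ /= scalerDl [e *: _ + _]addrC.
by rewrite opprD addrA addrK.
Qed.

Lemma shift_prodC s t z : shift_prod f s (shift_prod f t z) = shift_prod f t (shift_prod f s z).
Proof.
rewrite -(@shift_prod_intertwine (shift_prod f t) 0).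
  by congr shift_prod; rewrite -[LHS]map_id; apply: eq_map => e; rewrite addr0.
move=> {}z; rewrite scale0r addr0; elim: t => //= e t IHt.
by rewrite linearB linearZ /= IHt.
Qed.

(** For a fixed exponent this is a subspace, and for the Euler operator it is stable under every X_i
    and D_i. An exponent valid on generators is therefore valid on the whole module. *)
Definition eigen_killed a z :=
  forall c, exists s, c \notin s /\ shift_prod f s (shift_prod f (nseq a c) z) = 0.

Lemma subspace_eigen_killed a : is_subspace (eigen_killed a).
Proof.
split=> [c|b u v Eu Ev c]; first by exists [::]; rewrite /= linear0.
have [s [cs sE]] := Eu c; have [t [ct tE]] := Ev c; exists (s ++ t).
rewrite mem_cat negb_or cs ct; split=> //.
rewrite !shift_prod_linear !shift_prod_cat tE (shift_prodC s t) sE.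
by rewrite !(linear0 (shift_prod f _)) scaler0 addr0.
Qed.

Lemma eigen_killed_le a b z : (a <= b)%N -> eigen_killed a z -> eigen_killed b z.
Proof.
move=> ab Ez c; have [s [cs sE]] := Ez c; exists s; split=> //.
rewrite -(subnK ab) nseqD shift_prod_cat shift_prodC sE; exact: linear0.
Qed.

Lemma eigen_killed_intertwine (h : {linear V -> V}) k a z :
  (forall z, f (h z) = h (f z) + k *: h z) -> eigen_killed a z -> eigen_killed a (h z).
Proof.
move=> fh Ez c; have [s [cs sE]] := Ez (c - k); exists [seq e + k | e <- s]; split.
  by apply: contra cs => /mapP[e es /eqP]; rewrite -subr_eq => /eqP ->.
have -> : nseq a c = [seq e + k | e <- nseq a (c - k)] by rewrite map_nseq subrK.
by rewrite !(shift_prod_intertwine _ _ fh) sE linear0.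
Qed.

Lemma eigen_killed_eigenvector a d z : shift_prod f (nseq a d) z = 0 -> eigen_killed a z.
Proof.
move=> dz c; have [->|cd] := eqVneq c d; first by exists [::].
exists (nseq a d); rewrite mem_nseq (negbTE cd) andbF; split=> //.
by rewrite shift_prodC dz linear0.
Qed.

End ShiftProd.

Section Assembly.
Variables (K : fieldType) (n : nat) (N : lmodType K) (W : weyl_module n.+1 N).

Lemma weyl_monomial_subspace (U : set N) a b z :
  (forall i z, U z -> U (wX W i z) /\ U (wD W i z)) -> U z -> U (weyl_monomial W a b z).
Proof.
move=> st; have it (f : 'I_n.+1 -> N -> N) c s u : (forall i z, U z -> U (f i z)) ->
    U u -> U (foldr (fun i => iter (c i) (f i)) u s).
  move=> fU Uu; elim: s => //= i s IHs; elim: (c i) => //= k; exact: fU.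
move=> Uz; rewrite /weyl_monomial; apply: (it) => [i u /(st i)[] //|].
by apply: it => // i u /(st i)[].
Qed.

Lemma foldr_iter_delta (f : 'I_n.+1 -> N -> N) i z (s : seq 'I_n.+1) : uniq s ->
  foldr (fun j => iter (j == i) (f j)) z s = if i \in s then f i z else z.
Proof.
elim: s => //= j s IHs /andP[js /IHs->]; rewrite inE eq_sym.
by case: eqVneq => //= ->; rewrite (negbTE js).
Qed.

Lemma foldr_iter0 (f : 'I_n.+1 -> N -> N) z (s : seq 'I_n.+1) :
  foldr (fun j => iter 0 (f j)) z s = z.
Proof. by elim: s. Qed.

Lemma good_filtration_step G i t z : good_filtration W G -> G t z ->
  G t.+1 (wX W i z) /\ G t.+1 (wD W i z).
Proof.
move=> gG Gz.
have sumd : (\sum_(j < n.+1) (j == i : nat) + \sum_(j < n.+1) 0 <= 1)%N.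
  rewrite big1_eq addn0 (bigD1 i) //= eqxx big1 // => j /negbTE -> //.
have mem g : (exists a b : 'I_n.+1 -> nat, (\sum_(j < n.+1) a j + \sum_(j < n.+1) b j <= 1)%N
    /\ g = weyl_monomial W a b z) -> G t.+1 g.
  move=> [a [b [ab ->]]]; apply: (gf_mul gG (i := 1)).
  exists 1%N, (fun=> 1), (fun=> weyl_monomial W a b z); split.
    by move=> _; exists a, b, z.
  by rewrite big_ord_recl big_ord0 scale1r addr0.
split; apply: mem.
  exists (fun j => j == i), (fun=> 0%N); split; first exact: sumd.
  by rewrite /weyl_monomial foldr_iter0 foldr_iter_delta ?enum_uniq // mem_enum.
exists (fun=> 0%N), (fun j => j == i); split; first by rewrite addnC; exact: sumd.
by rewrite /weyl_monomial foldr_iter0 foldr_iter_delta ?enum_uniq // mem_enum.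
Qed.

Lemma poly_growth (P : {poly rat}) : exists C : nat,
  forall t, P.[t%:R] <= (C * t.+1 ^ (size P).-1)%:R.
Proof.
(* Each t^i with i at most the degree is below (t+1) to the degree, so the sum of the absolute
   values of the coefficients suffices. *)
pose c := \sum_(i < size P) `|P`_i|.
have c0 : 0 <= c by apply: sumr_ge0.
exists (Num.bound c) => t; rewrite natrM natrX.
apply: (@le_trans _ _ (c * t.+1%:R ^+ (size P).-1)); last first.
  by apply: ler_wpM2r; [apply: exprn_ge0|rewrite ltW // archi_boundP].
rewrite horner_coef mulr_suml; apply: ler_sum => i _.
apply: (le_trans (ler_norm _)); rewrite normrM ler_wpM2l //.
rewrite ger0_norm ?exprn_ge0 //; apply: (@le_trans _ _ (t.+1%:R ^+ i)).
  by apply: lerXn2r; rewrite ?nnegrE // ler_nat.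
by apply: ler_weXn2l; [rewrite ler1n|have := ltn_ord i; lia].
Qed.

Lemma hilbert_growth G P : good_filtration W G -> hilbert_poly G P ->
  growth G (size P).-1 [set: N]%classic [set 0]%classic.
Proof.
move=> gG [t0 hP]; have [C PC] := poly_growth P.
have bnd t r (e : 'I_r -> N) : (t0 <= t)%N -> (forall x, G t (e x)) ->
    qfree [set 0]%classic e -> (r <= C * t.+1 ^ (size P).-1)%N.
  move=> tt Ge fre; have [r' dimr Pr] := hP t tt.
  have le1 : (r <= r')%N := has_quot_dim_bound (subspace1 N) dimr Ge fre.
  by apply: (leq_trans le1); rewrite -(ler_nat rat) -Pr PC.
(* The Hilbert polynomial is valid only from t0 on; a smaller t is compared with max(t0, t), using
   max(t0, t) + 1 <= (t0 + 1)(t + 1). *)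
exists (C * t0.+1 ^ (size P).-1)%N => t r e Ge fre.
have Gm : {homo G : s t / (s <= t)%N >-> (s `<=` t)%classic}.
  by move=> s s' ss z; apply: (filtration_le (gf_incr gG)).
have := bnd (maxn t0 t) r e (leq_maxl _ _) _ fre.
move=> /(_ (fun x => Gm _ _ (leq_maxr _ _) _ (Ge x).2)) /leq_trans; apply.
rewrite -mulnA -expnMn leq_mul2l; apply/orP; right.
by case: (size P).-1 => // d; rewrite leq_exp2r // gtn_max; nia.
Qed.

Lemma euler_opE z : euler_op W z = euler_part W n.+1 z.
Proof. by apply: eq_bigl => i; rewrite ltn_ord. Qed.

Lemma eigen_killed_weyl a i z : eigen_killed (euler_part W n.+1) a z ->
  eigen_killed (euler_part W n.+1) a (wX W i z) /\
  eigen_killed (euler_part W n.+1) a (wD W i z).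
Proof.
move=> Ez; split.
  apply: (@eigen_killed_intertwine _ _ _ (wX W i) 1) => // {Ez}z.
  by rewrite scale1r; apply: euler_part_wX.
apply: (@eigen_killed_intertwine _ _ _ (wD W i) (- 1)) => // {Ez}z.
by rewrite scaleN1r; apply: euler_part_wD.
Qed.

Lemma graded_eigen_killed Ng z : is_graded W Ng -> generalized_eulerian W Ng ->
  exists a, eigen_killed (euler_part W n.+1) a z.
Proof.
move=> gr eul; have [s [f [Nf ->]]] := graded_gen gr z.
elim: s => [|d s [b Eb]].
  by exists 0%N; rewrite big_nil; apply: subspace0 (subspace_eigen_killed _ _).
have [a [_ fa]] := eul d _ (Nf d).
have {fa} Ea : eigen_killed (euler_part W n.+1) a (f d).
  apply: (@eigen_killed_eigenvector _ _ _ a d%:~R); rewrite -shift_prod_nseq -[RHS]fa.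
  by apply: eq_iter => w; rewrite euler_opE.
exists (maxn a b); rewrite big_cons; apply: (subspaceD (subspace_eigen_killed _ _)).
- exact: eigen_killed_le (leq_maxl a b) Ea.
- exact: eigen_killed_le (leq_maxr a b) Eb.
Qed.

(** Goodness makes the finite-dimensional [G t0] generate [N] over the Weyl algebra. Each vector of
    a basis of [G t0] has its own exponent, and the sum of these bounds them all. *)
Lemma uniform_eigen_exponent G Ng : good_filtration W G ->
  is_graded W Ng -> generalized_eulerian W Ng ->
  exists a, eigen_exponent a (euler_part W n.+1) [set: N]%classic [set 0]%classic.
Proof.
move=> gG gr eul; have [t0 good] := gf_good gG.
have [r [e [_ spe _]]] := gf_findim gG t0.
have /choice[a aP] := fun x => graded_eigen_killed (e x) gr eul.
exists (\sum_x a x)%N => c z _; move: c.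
have sE := subspace_eigen_killed (euler_part W n.+1) (\sum_x a x)%N.
have Gt0 u : G t0 u -> eigen_killed (euler_part W n.+1) (\sum_x a x)%N u.
  move=> /spe[c /eqP]; rewrite subr_eq0 => /eqP ->.
  apply: (subspace_sum _ sE) => x _; apply: (subspaceZ _ sE).
  by apply: eigen_killed_le (aP x); rewrite (bigD1 x) //= leq_addr.
suff : eigen_killed (euler_part W n.+1) (\sum_x a x)%N z.
  by move=> Ez c; have [s [cs sz]] := Ez c; exists s; rewrite shift_prod_nseq.
have [t Gz] := gf_exhaustive gG z.
have : G (t + t0)%N z by apply: (filtration_le (gf_incr gG)) Gz; apply: leq_addr.
rewrite good // => -[k [c [g [gP ->]]]]; apply: (subspace_sum _ sE) => x _.
apply: (subspaceZ _ sE); have [b [b' [u [_ Gu ->]]]] := gP x.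
apply: (weyl_monomial_subspace (U := eigen_killed _ _)) (Gt0 _ Gu).
by move=> i v; apply: eigen_killed_weyl.
Qed.

(** If x z = 0, then z / 1 = 0 in the localization, so z = 0. If y / 1 is the fraction z / x, then x
    y = z after cancelling powers of x. *)
Lemma localization_inverse (x : {linear N -> N}) : bijective (loc_map x) ->
  exists2 y : N -> N, cancel x y & cancel y x.
Proof.
move=> [g gK Kg].
have xI z : x z = 0 -> z = 0.
  move=> xz; apply: (can_inj gK); apply/eqmodP/asboolP; exists 1%N => /=.
  by rewrite xz linear0.
have injx : injective x.
  by move=> u v uv; apply/eqP; rewrite -subr_eq0; apply/eqP/xI; rewrite linearB uv subrr.
have /choice[y yP] : forall z, exists y, x y = z.
  move=> z; exists (g (\pi_(localization x) (z, 1%N))%qT).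
  have /eqmodP/asboolP[s] := Kg (\pi_(localization x) (z, 1%N))%qT.
  by rewrite /= -iterSr; elim: s => //= s IHs /injx.
by exists y => // z; apply: injx.
Qed.

(** * Comparison with the full de Rham complex *)

Lemma kcond_full p (J : {set 'I_n.+1}) : kcond n.+1 p J = (#|J|%:Z == p).
Proof.
by rewrite /kcond (_ : [forall i in J, _]) ?andbT //; apply/forall_inP => i _.
Qed.

Lemma koszul_diff_full w : koszul_diff W n.+1 w = dR_diff W w.
Proof.
by apply/ffunP => L; rewrite !ffunE; apply: eq_bigl => i; rewrite ltn_ord andbT.
Qed.

Lemma kform_full_setT (p : nat) : kform (m := n.+1) n.+1 [set: N]%classic p = dR_deg (N := N) p.
Proof.
apply/seteqP; split=> w Hw J; have := Hw J; rewrite kcond_full eqz_nat.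
  by case: ifP.
by case: eqVneq => // _; apply.
Qed.

Lemma kform_full_set0 p (w : dR_form n.+1 N) : kform n.+1 [set 0]%classic p w <-> w = 0.
Proof.
split=> [Hw|-> J]; last by rewrite ffunE if_same.
by apply/ffunP => J; rewrite ffunE; have := Hw J; case: ifP.
Qed.

Lemma dR_cocyclesE (p : nat) : dR_cocycles W p =
  cocycles (koszul_diff W n.+1) (kform n.+1 [set: N]%classic) (kform n.+1 [set 0]%classic) p.
Proof.
apply/seteqP; split=> w; rewrite /cocycles /dR_cocycles /= kform_full_setT => -[Zw Bw].
  by split=> //; apply/kform_full_set0; rewrite koszul_diff_full.
by split=> //; move/kform_full_set0: Bw; rewrite koszul_diff_full.
Qed.

Lemma dR_coboundariesE (p : nat) : dR_coboundaries W p =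
  coboundaries (koszul_diff W n.+1) (kform n.+1 [set: N]%classic) (kform n.+1 [set 0]%classic) p.
Proof.
have d0 : koszul_diff W n.+1 0 = 0 by rewrite linear0.
case: p => [|p]; apply/seteqP; split=> w.
- move=> ->; split; first by move=> J; rewrite ffunE; case: ifP.
  exists 0; last by apply/kform_full_set0; rewrite d0 subr0.
  exact (subspace0 (subspace_kform _ _ _ (subspaceT N))).
(* A form of degree -1 is zero, which matches the value [[set 0]] of [dR_coboundaries] in degree
   0. *)
- move=> [_ [y Zy /kform_full_set0]]; have -> : y = 0.
    by apply/ffunP => J; rewrite ffunE; exact: Zy J.
  by rewrite d0 subr0.
- rewrite /dR_coboundaries -kform_full_setT => -[y Zy <-].
  rewrite -koszul_diff_full intS addrC; split; first exact: kform_koszul_diff.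
  exists y; first by rewrite addrK.
  by rewrite subrr; apply/kform_full_set0.
- rewrite intS addrC => -[_ [y Zy /kform_full_set0/eqP]].
  rewrite subr_eq0 => /eqP ->; rewrite /dR_coboundaries -kform_full_setT.
  by exists y; [rewrite addrK in Zy|rewrite koszul_diff_full].
Qed.

Lemma dR_euler_charE x :
  koszul_char W n.+1 [set: N]%classic [set 0]%classic x -> dR_euler_char W = x.
Proof.
have C : subquot_complex (koszul_diff W n.+1) (kform n.+1 [set: N]%classic)
    (kform n.+1 [set 0]%classic).
  apply: koszul_complex => //; first exact: subspace1.
  by move=> i z _ ->; rewrite /= linear0.
move=> [h [dimh _ <-]]; rewrite /dR_euler_char; apply: eq_bigr => p _.
congr (_ * _%:Z); rewrite /dR_cohomology_dim dR_cocyclesE dR_coboundariesE.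
by apply: quot_dimE => //; apply: subspace_coboundaries C.
Qed.

End Assembly.

Theorem theorem1p3 (K : fieldType) (charK0 : [pchar K] =i pred0) (n : nat)
    (N : lmodType K) (W : weyl_module n.+1 N) (Ng : int -> set N)
    (grN : is_graded W Ng) (holN : holonomic W)
    (eulN : generalized_eulerian W Ng)
    (locN : bijective (loc_map (wX W ord0))) :
  dR_euler_char W = 0.
Proof.
have [y xK yK] := localization_inverse locN.
suff [G [a [GX GD GS GE [gr E]]]] : exists G a,
    [/\ forall i t z, G t z -> G t.+1 (wX W i z),
        forall i t z, G t z -> G t.+1 (wD W i z),
        forall t z, G t z -> G t.+1 z,
        forall z : N, exists t, G t z
      & growth G n.+1 [set: N]%classic [set 0]%classic /\
        eigen_exponent a (euler_part W n.+1) [set: N]%classic [set 0]%classic].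
  apply: dR_euler_charE.
  apply: (@koszul_char_vanish K n N W G charK0 GX GD GS GE y xK yK n _ _ a) => //.
    split=> //; first exact: subspace1.
    by move=> i z _ ->; rewrite /= !linear0.
  by move=> z ->; rewrite -[X in y X](linear0 (wX W ord0)) xK.
case: holN => [N0|[G [P [gG hP sP]]]].
  (* Zero module: the constant filtration works with growth constant 0, since no nonempty family is
     free. *)
  exists (fun=> [set: N]%classic), 0%N; split=> //.
  split; last by move=> c z _; exists [::]; split=> //; apply: N0.
  exists 0%N => t [//|r] e _ fre; have := fre (fun=> 1) (N0 _) ord0.
  by move=> /eqP; rewrite oner_eq0.
have [a E] := uniform_eigen_exponent gG grN eulN.
exists G, a; split.
- by move=> i t z /(good_filtration_step i gG)[].
- by move=> i t z /(good_filtration_step i gG)[].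
- exact: gf_incr gG.
- exact: gf_exhaustive gG.
(* Holonomicity gives [size P = n.+2], so the growth exponent equals the number of variables, and
   peeling them all off brings it to 0. *)
- by split=> //; have := hilbert_growth gG hP; rewrite sP.
Qed.
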